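(* The graph $2C_5$ (disjoint union of two chordless 5-cycles) is gap-extremal. In particular, $s(2)=s_2(2)=10$ and the only $2$-extremal graph is $2C_5$. Consequently, for $n=6,7,8,9$, the disjoint union of $C_5$ with an arbitrary graph on $n-5$ vertices has maximum gap among graphs on $n$ vertices. In addition: (1) for $n=6$, the disjoint union of $C_5$ and an isolated vertex is the unique graph of maximum gap on $6$ vertices, and it is stable gap-optimal; (2) for $n=7$, the gaps of $C_7$ and of its complement $\overline{C_7}$ are maximum among graphs on $7$ vertices, as is the gap of $R-v$ for any $(3,4)$-Ramsey graph $R$ and any $v\in V(R)$; the graphs $R-v$ are stable gap-optimal; (3) for $n=8$, the stable gap-optimal graphs are exactly the $(3,4)$-Ramsey graphs; (4) for $n=9$, a graph $G$ on $9$ vertices is stable gap-optimal if and only if it is triangle-free and $\alpha(G)=4$.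
   Context: All graphs are finite, simple and undirected. $\alpha(G)$ denotes the maximum size of a stable set, $\omega(G)$ the maximum size of a clique, $\theta(G)$ the minimum number of cliques partitioning $V(G)$, and $\mathrm{gap}(G)=\theta(G)-\alpha(G)$. $s(t)$ (resp. $s_2(t)$) is the smallest number of vertices of a graph (resp. triangle-free graph) with gap $t$. A graph is $t$-extremal if it has gap $t$ and $s(t)$ vertices, and gap-extremal if it is $t$-extremal for some $t$. $\mathrm{gap}_2(n)$ is the maximum gap of a triangle-free graph on $n$ vertices. $\alpha(n)$ is the minimum of $\alpha(G)$ over triangle-free graphs on $n$ vertices. A graph $G$ on $n$ vertices is stable gap-optimal if it is triangle-free, $\mathrm{gap}(G)=\mathrm{gap}_2(n)$ and $\alpha(G)=\alpha(n)$. A $(3,4)$-Ramsey graph is a graph of maximum order among graphs with no triangle and no stable set of size $4$; such graphs have $8$ vertices.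
   Formalization: In (1), uniqueness of the disjoint union of C5 and an isolated vertex is stated only among triangle-free graphs of maximum gap on 6 vertices; among all graphs it fails, since C5 plus a vertex joined to all of it (the wheel) also has gap 1. *)

(* Defs.v *)
From mathcomp Require Import all_boot.

Set Implicit Arguments.
Unset Strict Implicit.
Unset Printing Implicit Defensive.

Record sgraph := SGraph {
  vertex :> finType;
  adj : rel vertex;
  adj_sym : symmetric adj;
  adj_irr : irreflexive adj }.

Definition iso (G H : sgraph) : Prop :=
  exists f : G -> H, bijective f /\ forall x y, adj (f x) (f y) = adj x y.

Section Invariants.
Variable G : sgraph.

Definition stable (S : {set G}) : bool :=
  [forall x in S, forall y in S, ~~ adj x y].

Definition clique (K : {set G}) : bool :=
  [forall x in K, forall y in K, (x != y) ==> adj x y].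

Definition alpha : nat := \max_(S : {set G} | stable S) #|S|.

Definition clique_partition (P : {set {set G}}) : bool :=
  partition P [set: G] && [forall K in P, clique K].

Definition singletons : {set {set G}} := [set [set x] | x : G].

(* The starting point [singletons] of [arg min] is a clique partition, see
   [singletonsP], so this is a genuine minimum, see [thetaP]. *)
Definition theta : nat :=
  #|[arg min_(P < singletons | clique_partition P) #|P|]|.

(* The truncated subtraction is harmless, see [alpha_le_theta]. *)
Definition gap : nat := theta - alpha.

Definition triangle_free : Prop :=
  ~ exists x y z : G, [/\ adj x y, adj y z & adj x z].

Lemma singletonsP : clique_partition singletons.
Proof.
apply/andP; split.
  apply/and3P; split.
  - rewrite eqEsubset subsetT /=; apply/subsetP => x _.
    by apply/bigcupP; exists [set x]; [apply: imset_f | rewrite inE].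
  - apply/trivIsetP => A B /imsetP[x _ ->] /imsetP[y _ ->] xy.
    by rewrite disjoints1 inE; apply: contra_neqN xy => /eqP->.
  - by apply/imsetP => -[x _ /setP/(_ x)]; rewrite !inE eqxx.
apply/forall_inP => K /imsetP[x _ ->].
apply/forall_inP => y /set1P->; apply/forall_inP => z /set1P->.
by rewrite eqxx.
Qed.

Lemma thetaP :
  (exists2 P, clique_partition P & #|P| = theta) /\
  (forall P, clique_partition P -> theta <= #|P|).
Proof.
rewrite /theta; case: arg_minnP => [|P cP minP]; first exact: singletonsP.
by split; [exists P | exact: minP].
Qed.

Lemma alpha_le_theta : alpha <= theta.
Proof.
have [[P /andP[partP /forall_inP cliqP] <-] _] := thetaP.
apply/bigmax_leqP => S /forall_inP stS.
have covP x : x \in cover P by rewrite (cover_partition partP) inE.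
rewrite -(card_in_imset (f := pblock P)) => [|x y xS yS eqxy].
  apply/subset_leq_card/subsetP => _ /imsetP[x _ ->]; exact: pblock_mem.
apply/eqP/negPn/negP => neqxy.
have /forall_inP/(_ x) := cliqP _ (pblock_mem (covP x)).
rewrite mem_pblock => /(_ (covP x)) /forall_inP/(_ y).
rewrite eqxy mem_pblock => /(_ (covP y)).
by rewrite neqxy /= (negPf (forall_inP (stS x xS) y yS)).
Qed.

End Invariants.

(* n >= 3 is intended: the cycle of length n. *)
Definition cycle_adj (n : nat) : rel 'I_n := fun i j =>
  (i != j) && ((i.+1 %% n == j) || (j.+1 %% n == i)).

Lemma cycle_adj_sym n : symmetric (@cycle_adj n).
Proof. by move=> i j; rewrite /cycle_adj eq_sym orbC. Qed.

Lemma cycle_adj_irr n : irreflexive (@cycle_adj n).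
Proof. by move=> i; rewrite /cycle_adj eqxx. Qed.

Definition cycle_graph (n : nat) : sgraph :=
  SGraph (@cycle_adj_sym n) (@cycle_adj_irr n).

Definition edgeless_adj (n : nat) : rel 'I_n := fun _ _ => false.

Lemma edgeless_adj_sym n : symmetric (@edgeless_adj n).
Proof. by []. Qed.

Lemma edgeless_adj_irr n : irreflexive (@edgeless_adj n).
Proof. by []. Qed.

Definition edgeless (n : nat) : sgraph :=
  SGraph (@edgeless_adj_sym n) (@edgeless_adj_irr n).

Section Operations.
Variables G H : sgraph.

Definition dunion_adj : rel (G + H)%type := fun u v =>
  match u, v with
  | inl x, inl y => adj x y
  | inr x, inr y => adj x y
  | _, _ => false
  end.

Lemma dunion_adj_sym : symmetric dunion_adj.
Proof. by move=> [x|x] [y|y] //=; exact: adj_sym. Qed.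

Lemma dunion_adj_irr : irreflexive dunion_adj.
Proof. by move=> [x|x] /=; exact: adj_irr. Qed.

Definition dunion : sgraph := SGraph dunion_adj_sym dunion_adj_irr.

Definition compl_adj : rel G := fun x y => (x != y) && ~~ adj x y.

Lemma compl_adj_sym : symmetric compl_adj.
Proof. by move=> x y; rewrite /compl_adj eq_sym adj_sym. Qed.

Lemma compl_adj_irr : irreflexive compl_adj.
Proof. by move=> x; rewrite /compl_adj eqxx. Qed.

Definition compl : sgraph := SGraph compl_adj_sym compl_adj_irr.

Variable v : G.

Definition delete_adj : rel {x : G | x != v} := fun x y => adj (val x) (val y).

Lemma delete_adj_sym : symmetric delete_adj.
Proof. by move=> x y; exact: adj_sym. Qed.

Lemma delete_adj_irr : irreflexive delete_adj.
Proof. by move=> x; exact: adj_irr. Qed.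

Definition delete : sgraph := SGraph delete_adj_sym delete_adj_irr.

End Operations.

Definition is_min (P : nat -> Prop) (m : nat) : Prop :=
  P m /\ forall k, P k -> m <= k.

Definition is_max (P : nat -> Prop) (m : nat) : Prop :=
  P m /\ forall k, P k -> k <= m.

(* [is_s t m], [is_s2 t m], [is_gap2 n m] and [is_alpha_min n m] say that m is
   the value of s(t), s_2(t), gap_2(n) and alpha(n), respectively. *)
Definition is_s (t m : nat) : Prop :=
  is_min (fun k => exists G : sgraph, #|G| = k /\ gap G = t) m.

Definition is_s2 (t m : nat) : Prop :=
  is_min (fun k => exists G : sgraph,
    [/\ #|G| = k, triangle_free G & gap G = t]) m.

Definition is_gap2 (n m : nat) : Prop :=
  is_max (fun k => exists G : sgraph,
    [/\ #|G| = n, triangle_free G & gap G = k]) m.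

Definition is_alpha_min (n m : nat) : Prop :=
  is_min (fun k => exists G : sgraph,
    [/\ #|G| = n, triangle_free G & alpha G = k]) m.

Definition t_extremal (t : nat) (G : sgraph) : Prop :=
  gap G = t /\ is_s t #|G|.

Definition gap_extremal (G : sgraph) : Prop := exists t, t_extremal t G.

Definition max_gap (n : nat) (G : sgraph) : Prop :=
  #|G| = n /\ forall H : sgraph, #|H| = n -> gap H <= gap G.

Definition stable_gap_optimal (n : nat) (G : sgraph) : Prop :=
  [/\ #|G| = n, triangle_free G, is_gap2 n (gap G) & is_alpha_min n (alpha G)].

Definition no_triangle_no_stable4 (G : sgraph) : Prop :=
  triangle_free G /\ ~ exists2 S : {set G}, stable S & #|S| = 4.

Definition ramsey34 (G : sgraph) : Prop :=
  no_triangle_no_stable4 G /\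
  forall H : sgraph, no_triangle_no_stable4 H -> #|H| <= #|G|.

Notation C5 := (cycle_graph 5).
Notation C7 := (cycle_graph 7).
Notation K1 := (edgeless 1).

(* Main.v *)
Require Import Defs.
From mathcomp Require Import all_boot.

Set Implicit Arguments.
Unset Strict Implicit.
Unset Printing Implicit Defensive.

(** A graph G with at most 10 vertices and gap at least 2 is 2C5, by induction on
    its order: all smaller graphs may be assumed to have gap at most 1.

    If G has a triangle T, add isolated vertices to reach 10 vertices and let F be
    G - T, with 7 vertices.  Removing a clique lowers theta by at most 1, so
    alpha(G) = alpha(F) = a and theta(G) = a + 2 are forced, and every vertex of T
    is adjacent to a transversal of the maximum stable sets of F.  An enumeration
    of the graphs F shows that some partition of F into a + 1 cliques then always
    absorbs T, a contradiction.

    If G is triangle-free and disconnected, two parts have gap 1, hence are copies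
    of C5.  If it is connected, then theta(G - v) < theta(G) for all v, and theta
    is the order minus the matching number, so Gallai's lemma gives
    2 theta(G) <= |G| + 1, which contradicts R(3,3) = 6 and R(3,4) = 9. *)

(** * Stable sets and clique colorings *)

(** The obstacle is size: graphs on 10 vertices are too many to enumerate, while the link between
    theta and matchings breaks down as soon as there are triangles. Deleting a triangle T leaves 7
    vertices, and the 21 possible edges between T and the rest are not enumerated either: maximality
    of alpha forces each vertex of T to be adjacent to a whole minimal transversal, and larger
    neighborhoods only make absorption easier. An isolated vertex raises alpha and theta alike, so
    padding preserves the gap and the single order 10 = 3 + 7 serves all graphs with a triangle. In
    the connected triangle-free case, Gallai's bound limits theta, hence alpha, which is at most
    theta - 2; a Ramsey bound then limits the order, and the two alternate until nothing is left. *)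

Definition clique_coloring (G : sgraph) (C : finType) (c : G -> C) : Prop :=
  forall x y, c x = c y -> x != y -> adj x y.

Definition isometric (G H : sgraph) (h : G -> H) : Prop :=
  injective h /\ forall x y, adj (h x) (h y) = adj x y.

Definition homog (G : sgraph) (b : bool) (s : seq G) : Prop :=
  {in s &, forall x y, x != y -> adj x y = b}.

Section Invariants.
Variable G : sgraph.

(** Color classes are cliques, and only the colors in use are counted. With [theta_coloring] this
    replaces partitions by maps into an arbitrary finite type, which are easier to compose and
    restrict. *)
Lemma theta_le_coloring (C : finType) (c : G -> C) :
  clique_coloring c -> theta G <= #|c @: [set: G]|.
Proof.
move=> cc; have [_ /(_ (preim_partition c [set: G])) le] := thetaP G.
apply: leq_trans (le _) _.
  apply/andP; split; first exact: preim_partitionP.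
  apply/forall_inP => K /imsetP[z _ ->]; apply/forall_inP => x.
  rewrite !inE => /eqP zx; apply/forall_inP => y; rewrite !inE => /eqP zy.
  by apply/implyP/cc; rewrite -zx.
rewrite (_ : preim_partition _ _ =
  (fun i => [set y in [set: G] | i == c y]) @: (c @: [set: G])).
  exact: leq_imset_card.
by rewrite -imset_comp.
Qed.

Lemma theta_le_card : theta G <= #|G|.
Proof.
by apply: leq_trans (theta_le_coloring (c := id) _) (max_card _) => x y -> /eqP.
Qed.

Lemma theta_coloring :
  exists2 c : G -> {set G}, clique_coloring c & #|c @: [set: G]| <= theta G.
Proof.
have [[P /andP[partP /forall_inP cliqP] <-] _] := thetaP G.
have covP x : x \in cover P by rewrite (cover_partition partP) inE.
exists (pblock P).
  move=> x y xy neq.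
  have /forall_inP/(_ x) := cliqP _ (pblock_mem (covP x)).
  rewrite mem_pblock => /(_ (covP x))/forall_inP/(_ y).
  by rewrite xy mem_pblock neq => /(_ (covP y)).
by apply/subset_leq_card/subsetP => _ /imsetP[x _ ->]; exact: pblock_mem.
Qed.

(** The cliques may overlap: each vertex is colored by the position of the first clique containing
    it. *)
Lemma theta_le_cover (Bs : seq (seq G)) :
  (forall B, B \in Bs -> homog true B) ->
  (forall x, has (fun B => x \in B) Bs) -> theta G <= size Bs.
Proof.
move=> cB cov.
have lt x : find (fun B => x \in B) Bs < size Bs by rewrite -has_find.
rewrite -[X in _ <= X]card_ord.
apply: leq_trans (theta_le_coloring (c := fun x => Ordinal (lt x)) _) (max_card _).
move=> x y [eq] neq.
have hx := nth_find [::] (cov x); have hy := nth_find [::] (cov y).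
by apply: (cB _ (mem_nth [::] (lt x))) neq => //; rewrite eq.
Qed.

Lemma stableP (S : {set G}) :
  reflect {in S &, forall x y, ~~ adj x y} (stable S).
Proof.
apply: (iffP forall_inP) => [h x y xS yS|h x xS]; first exact: (forall_inP (h x xS)).
by apply/forall_inP => y yS; apply: h.
Qed.

Lemma leq_alpha (S : {set G}) : stable S -> #|S| <= alpha G.
Proof. by move=> st; rewrite /alpha (bigmax_sup S). Qed.

Lemma alpha_witness : exists2 S : {set G}, stable S & #|S| = alpha G.
Proof.
have s0 : stable (set0 : {set G}) by apply/stableP => x y; rewrite inE.
rewrite /alpha (bigmax_eq_arg set0) //.
by case: arg_maxnP => // S sS _; exists S.
Qed.

Lemma stable_sub (S S' : {set G}) : S \subset S' -> stable S' -> stable S.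
Proof.
move=> /subsetP sub /stableP st; apply/stableP => x y xS yS.
by apply: st; apply: sub.
Qed.


Lemma stable_subcard k : k <= alpha G -> exists2 S : {set G}, stable S & #|S| = k.
Proof.
have [S st <-] := alpha_witness => /card_geqP[s [us <- sub]].
exists [set x in s]; last by rewrite cardsE; apply/card_uniqP.
by apply: stable_sub st; apply/subsetP => x; rewrite inE => /sub.
Qed.

Lemma homog_alpha (s : seq G) : uniq s -> homog false s -> size s <= alpha G.
Proof.
move=> us hs; rewrite -(card_uniqP us) -cardsE; apply/leq_alpha/stableP => x y.
rewrite !inE => xs ys; have [->|neq] := eqVneq x y; first by rewrite adj_irr.
by rewrite hs.
Qed.

Lemma gap_le (k : nat) : theta G <= alpha G + k -> gap G <= k.
Proof. by move=> le; rewrite /gap leq_subLR. Qed.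

Lemma gap_ge (k : nat) : alpha G + k <= theta G -> k <= gap G.
Proof. by move=> le; rewrite /gap leq_subRL // (leq_trans _ le) // leq_addr. Qed.

Lemma theta_gap : theta G = alpha G + gap G.
Proof. by rewrite /gap subnKC // alpha_le_theta. Qed.

End Invariants.

Section Comparison.
Variables G H : sgraph.

Lemma alpha_isometric (h : G -> H) : isometric h -> alpha G <= alpha H.
Proof.
case=> hi hadj; have [S /stableP st <-] := alpha_witness G.
rewrite -(card_imset _ hi); apply/leq_alpha/stableP => _ _ /imsetP[x xS ->] /imsetP[y yS ->].
by rewrite hadj; apply: st.
Qed.

Lemma theta_isometric (h : G -> H) : isometric h -> theta G <= theta H.
Proof.
case=> hi hadj; have [c cc le] := theta_coloring H.
apply: leq_trans le; apply: leq_trans (theta_le_coloring (c := c \o h) _) _.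
  by move=> x y /cc /=; rewrite hadj inj_eq // => h'; apply: h'.
by rewrite imset_comp; apply/subset_leq_card/imsetS/subsetT.
Qed.

Lemma iso_isometric : iso G H -> exists2 h : G -> H, isometric h & bijective h.
Proof. by case=> f [bf adjf]; exists f => //; split=> //; exact: bij_inj. Qed.

End Comparison.

Lemma iso_sym (G H : sgraph) : iso G H -> iso H G.
Proof.
case=> f [[g fK gK] adjf]; exists g; split; first by exists f.
by move=> x y; rewrite -adjf !gK.
Qed.

Lemma iso_trans (G H K : sgraph) : iso G H -> iso H K -> iso G K.
Proof.
move=> [f [bf af]] [g [bg ag]]; exists (g \o f); split; first exact: bij_comp.
by move=> x y /=; rewrite ag af.
Qed.

Lemma iso_invariants (G H : sgraph) : iso G H ->
  [/\ #|G| = #|H|, alpha G = alpha H & theta G = theta H].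
Proof.
move=> i; have [h hi hb] := iso_isometric i; have [g gi _] := iso_isometric (iso_sym i).
split; first exact: bij_eq_card hb.
  by apply/eqP; rewrite eqn_leq (alpha_isometric hi) (alpha_isometric gi).
by apply/eqP; rewrite eqn_leq (theta_isometric hi) (theta_isometric gi).
Qed.

Lemma iso_gap (G H : sgraph) : iso G H -> gap G = gap H.
Proof. by move=> /iso_invariants[_ a t]; rewrite /gap a t. Qed.

(** * Disjoint unions and induced subgraphs *)

Section Dunion.
Variables G H : sgraph.

Lemma card_dunion : #|dunion G H| = #|G| + #|H|.
Proof. exact: card_sum. Qed.

Lemma alpha_dunion : alpha (dunion G H) = alpha G + alpha H.
Proof.
apply/eqP; rewrite eqn_leq; apply/andP; split.
  have [S /stableP st <-] := alpha_witness (dunion G H).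
  have -> : S = (inl @: (inl @^-1: S)) :|: (inr @: (inr @^-1: S)).
    apply/setP => -[x|x]; rewrite inE.
      rewrite (mem_imset _ _ inl_inj) inE [X in _ || X](_ : _ = false) ?orbF //.
      by apply/imsetP => -[].
    rewrite (mem_imset _ _ inr_inj) inE [X in X || _](_ : _ = false) //.
    by apply/imsetP => -[].
  apply: leq_trans (leq_card_setU _ _) _.
  rewrite (card_imset _ inl_inj) (card_imset _ inr_inj); apply: leq_add.
    by apply/leq_alpha/stableP => x y; rewrite !inE => xS yS; apply: (st _ _ xS yS).
  by apply/leq_alpha/stableP => x y; rewrite !inE => xS yS; apply: (st _ _ xS yS).
have [S /stableP sS <-] := alpha_witness G; have [S' /stableP sS' <-] := alpha_witness H.
rewrite -(card_imset S (@inl_inj G H)) -(card_imset S' (@inr_inj G H)).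
set A := @inl G H @: S; set B := @inr G H @: S'.
have <- : #|A :|: B| = #|A| + #|B|.
  apply/eqP; rewrite (leq_card_setU _ _); apply/pred0P => u /=; apply/andP => -[].
  by move=> /imsetP[x _ ->] /imsetP[].
apply/leq_alpha/stableP => u v; rewrite !inE.
by case/orP => /imsetP[x xS ->]; case/orP => /imsetP[y yS ->] //=; [exact: sS|exact: sS'].
Qed.

Lemma theta_dunion : theta (dunion G H) = theta G + theta H.
Proof.
apply/eqP; rewrite eqn_leq; apply/andP; split.
  have [c cc lec] := theta_coloring G; have [d cd led] := theta_coloring H.
  pose e (u : dunion G H) : {set G} + {set H} :=
    match u with inl x => inl (c x) | inr x => inr (d x) end.
  apply: leq_trans (theta_le_coloring (c := e) _) _.
    move=> [x|x] [y|y] //= [eq]; rewrite /eq_op /= => neq; [exact: cc|exact: cd].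
  apply: leq_trans (leq_add lec led).
  rewrite -(card_imset _ (@inl_inj {set G} {set H})) -(card_imset _ (@inr_inj {set G} {set H})).
  apply: leq_trans (leq_card_setU _ _); apply/subset_leq_card/subsetP => _ /imsetP[[x|x] _ ->].
    by rewrite inE; apply/orP; left; do 2 apply: imset_f.
  by rewrite inE; apply/orP; right; do 2 apply: imset_f.
have [c cc lec] := theta_coloring (dunion G H); apply: leq_trans lec.
apply: leq_trans (leq_add (theta_le_coloring (c := c \o inl) _)
                          (theta_le_coloring (c := c \o inr) _)) _.
- by move=> x y /cc h neq; apply: (h neq).
- by move=> x y /cc h neq; apply: (h neq).
(* No color occurs on both sides, since it would make a vertex of [G] adjacent to one of [H]. *)
have <- : #|(c \o inl) @: [set: G] :|: (c \o inr) @: [set: H]|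
    = #|(c \o inl) @: [set: G]| + #|(c \o inr) @: [set: H]| :> nat.
  apply/eqP; rewrite (leq_card_setU _ _); apply/pred0P => A /=; apply/andP => -[].
  by move=> /imsetP[x _ ->] /imsetP[y _ /cc h]; have := h isT.
apply/subset_leq_card/subsetP => A; rewrite inE.
by case/orP => /imsetP[x _ ->]; apply: imset_f.
Qed.

Lemma gap_dunion : gap (dunion G H) = gap G + gap H.
Proof.
apply/eqP; rewrite -(eqn_add2l (alpha (dunion G H))) -theta_gap.
by rewrite theta_dunion alpha_dunion !theta_gap addnACA.
Qed.

Lemma triangle_free_dunion :
  triangle_free G -> triangle_free H -> triangle_free (dunion G H).
Proof.
move=> tG tH [[x|x] [[y|y] [[z|z] [] //= a b d]]]; first by apply: tG; exists x, y, z.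
by apply: tH; exists x, y, z.
Qed.

End Dunion.

Lemma iso_dunion (G G' H H' : sgraph) :
  iso G G' -> iso H H' -> iso (dunion G H) (dunion G' H').
Proof.
move=> [f [[f' fK f'K] af]] [g [[g' gK g'K] ag]].
exists (fun u => match u with inl x => inl (f x) | inr x => inr (g x) end); split.
  exists (fun u => match u with inl x => inl (f' x) | inr x => inr (g' x) end).
    by move=> [x|x]; rewrite ?fK ?gK.
  by move=> [x|x]; rewrite ?f'K ?g'K.
by move=> [x|x] [y|y] //=.
Qed.

Lemma alpha_edgeless n : alpha (edgeless n) = n.
Proof.
apply/eqP; rewrite eqn_leq; apply/andP; split.
  have [S _ <-] := alpha_witness (edgeless n).
  by rewrite -[X in _ <= X]card_ord max_card.
by rewrite -{1}(card_ord n) -cardsT; apply/leq_alpha/stableP.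
Qed.

Lemma gap_edgeless n : gap (edgeless n) = 0.
Proof.
apply/eqP; rewrite -leqn0; apply: gap_le; rewrite addn0 alpha_edgeless.
by rewrite -[X in _ <= X]card_ord theta_le_card.
Qed.

Section Induced.
Variables (G : sgraph) (A : {set G}).

Definition induced_adj : rel {x : G | x \in A} := fun x y => adj (val x) (val y).

Lemma induced_adj_sym : symmetric induced_adj.
Proof. by move=> x y; exact: adj_sym. Qed.

Lemma induced_adj_irr : irreflexive induced_adj.
Proof. by move=> x; exact: adj_irr. Qed.

Definition induced : sgraph := SGraph induced_adj_sym induced_adj_irr.

Lemma card_induced : #|induced| = #|A|.
Proof. by rewrite card_sig; apply: eq_card. Qed.

Lemma induced_isometric : isometric (val : induced -> G).
Proof. by split=> //; exact: val_inj. Qed.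

End Induced.

Lemma iso_dunion_induced (G : sgraph) (A : {set G}) :
  (forall x y, x \in A -> y \notin A -> ~~ adj x y) ->
  iso (dunion (induced A) (induced (~: A))) G.
Proof.
move=> sep.
exists (fun u => match u with inl x => val x | inr x => val x end); split.
  apply: inj_card_bij; last first.
    by rewrite card_dunion !card_induced cardsC.
  move=> [[x xA]|[x xA]] [[y yA]|[y yA]] /= eq.
  - by congr inl; apply: val_inj.
  - by exfalso; move: yA; rewrite -eq inE xA.
  - by exfalso; move: yA; rewrite -eq; apply/negP; rewrite inE in xA.
  - by congr inr; apply: val_inj.
move=> [[x xA]|[x xA]] [[y yA]|[y yA]] //=.
  by apply/negbTE/sep => //; move: yA; rewrite inE.
by rewrite adj_sym; apply/negbTE/sep => //; move: xA; rewrite inE.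
Qed.

(** [v] receives the fresh color [None] and is alone in its class; in a triangle-free graph such a
    coloring becomes a matching that misses [v]. *)
Lemma theta_critical_coloring (G : sgraph) (v : G) :
  exists (C : finType) (c : G -> C), [/\ clique_coloring c,
    #|c @: [set: G]| <= (theta (induced [set~ v])).+1 & forall x, c x = c v -> x = v].
Proof.
have [c cc le] := theta_coloring (induced [set~ v]).
pose d (x : G) : option {set induced [set~ v]} :=
  omap c (insub x : option (induced [set~ v])).
have dv : d v = None by rewrite /d insubF // !inE eqxx.
have dvx x : d x = d v -> x = v.
  rewrite dv /d; case: insubP => //= nx _; apply/eqP.
  by move: nx; rewrite !inE negbK.
exists _, d; split=> //.
  move=> x y; have [->|nx] := eqVneq x v; first by move=> /esym/dvx ->; rewrite eqxx.
  have [->|ny] := eqVneq y v; first by move=> /dvx ->; rewrite eqxx.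
  rewrite /d; case: insubP => [u _ ux|]; last by rewrite !inE nx.
  case: insubP => [w _ wx|]; last by rewrite !inE ny.
  by case=> /cc; rewrite -ux -wx => h neq; apply: h.
apply: leq_trans (_ : #|None |: Some @: (c @: [set: induced [set~ v]])| <= _).
  apply/subset_leq_card/subsetP => _ /imsetP[x _ ->]; rewrite inE.
  rewrite /d; case: insub => [u|] /=; last by rewrite inE.
  by apply/orP; right; do 2 apply: imset_f.
rewrite cardsU1 -add1n; apply: leq_add; first by case: (_ \in _).
by rewrite card_imset //; exact: Some_inj.
Qed.

(** * Ramsey bounds *)

Section Ramsey.

Lemma triangle_freeW (G H : sgraph) (h : G -> H) :
  isometric h -> triangle_free H -> triangle_free G.
Proof.
move=> [_ ha] tH [x [y [z [a b c]]]]; apply: tH.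
by exists (h x), (h y), (h z); rewrite !ha.
Qed.

Definition nbrs (G : sgraph) (v : G) : {set G} := [set y | adj v y].

Lemma degree_le_alpha (G : sgraph) (v : G) : triangle_free G -> #|nbrs v| <= alpha G.
Proof.
move=> tf; apply/leq_alpha/stableP => x y; rewrite !inE => vx vy.
by apply/negP => xy; apply: tf; exists v, x, y.
Qed.

Lemma card_nbrs (G : sgraph) (v : G) : #|G| = (#|nbrs v| + #|~: (v |: nbrs v)|).+1.
Proof. by rewrite -(cardsC (v |: nbrs v)) cardsU1 inE adj_irr. Qed.

Lemma alpha_nonnbrs (G : sgraph) (v : G) :
  (alpha (induced (~: (v |: nbrs v)))).+1 <= alpha G.
Proof.
set A := ~: _; have [S /stableP st <-] := alpha_witness (induced A).
rewrite -(card_imset _ val_inj).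
have nin (u : induced A) : (v != val u) && ~~ adj v (val u).
  by have := valP u; rewrite !inE negb_or eq_sym.
have -> : (#|[set val u | u in S]|).+1 = #|v |: [set val u | u in S]|.
  rewrite cardsU1; case: imsetP => // -[u _ eq].
  by have /andP[] := nin u; rewrite -eq eqxx.
apply/leq_alpha/stableP => x y; rewrite !inE.
case/orP => [/eqP->|/imsetP[u uS ->]]; case/orP => [/eqP->|/imsetP[w wS ->]].
- by rewrite adj_irr.
- by have /andP[] := nin w.
- by rewrite adj_sym; have /andP[] := nin u.
- exact: (st _ _ uS wS).
Qed.

Lemma ramsey_step (m k : nat) (G : sgraph) (v : G) :
  (forall H : sgraph, triangle_free H -> m <= #|H| -> k <= alpha H) ->
  triangle_free G -> m + k < #|G| -> #|nbrs v| <= k -> k < alpha G.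
Proof.
move=> IH tf cG dv; apply: leq_trans (alpha_nonnbrs v); rewrite ltnS; apply: IH.
  exact: triangle_freeW (induced_isometric _) tf.
rewrite card_induced; move: cG; rewrite (card_nbrs v) ltnS => h.
by rewrite -(leq_add2l #|nbrs v|); apply: leq_trans h; rewrite addnC leq_add2l.
Qed.

(** The recursion R(3,k+1) <= R(3,k) + k + 1: a vertex of degree above [k] has a stable neighborhood
    of that size; otherwise at least [m] non-neighbors remain, and the vertex extends a stable
    [k]-set among them. From 0 it yields 1, 3, 6, and then 10, one more than R(3,4). *)
Lemma ramsey_lt (m k : nat) (G : sgraph) :
  (forall H : sgraph, triangle_free H -> m <= #|H| -> k <= alpha H) ->
  triangle_free G -> m + k < #|G| -> k < alpha G.
Proof.
move=> IH tf cG; have /card_gt0P[v _] : 0 < #|G| by case: #|G| cG.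
have [|h] := leqP #|nbrs v| k; first exact: ramsey_step cG.
exact: leq_trans h (degree_le_alpha v tf).
Qed.

Lemma ramsey31_alpha (G : sgraph) : triangle_free G -> 1 <= #|G| -> 1 <= alpha G.
Proof. by move=> tf cG; apply: (@ramsey_lt 0 0). Qed.

Lemma ramsey32_alpha (G : sgraph) : triangle_free G -> 3 <= #|G| -> 2 <= alpha G.
Proof. exact: ramsey_lt ramsey31_alpha. Qed.

Lemma ramsey33_alpha (G : sgraph) : triangle_free G -> 6 <= #|G| -> 3 <= alpha G.
Proof. exact: ramsey_lt ramsey32_alpha. Qed.

(** Handshake lemma: [enum_rank] orders the vertices, and each edge is counted once from its lower
    and once from its upper end. *)
Lemma sum_degrees_even (G : sgraph) : ~~ odd (\sum_(x : G) #|nbrs x|).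
Proof.
pose r (x : G) : nat := enum_rank x.
have -> : \sum_(x : G) #|nbrs x| = \sum_(x : G) \sum_(y : G) adj x y.
  by apply: eq_bigr => x _; rewrite -sum1dep_card -big_mkcond.
pose E := \sum_(x : G) \sum_(y : G | r x < r y) adj x y.
suff -> : \sum_(x : G) \sum_(y : G) adj x y = E + E by rewrite addnn odd_double.
under eq_bigr => x _ do rewrite (bigID (fun y => r x < r y)) /=.
rewrite big_split /=; congr (_ + _); rewrite [RHS](exchange_big_dep predT) //=.
apply: eq_bigr => x _; rewrite big_mkcond [RHS]big_mkcond /=; apply: eq_bigr => y _.
case: (ltngtP (r x) (r y)) => //= [_|/val_inj/enum_rank_inj->].
  by rewrite adj_sym.
by rewrite adj_irr.
Qed.

(** If alpha is at most 3, degrees are at most 3 because neighborhoods are stable, and at least 3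
    because six non-neighbors would contain a stable 3-set. The general recursion excludes 10
    vertices, and a cubic graph on 9 vertices would have the odd degree sum 27. *)
Lemma ramsey34_alpha (G : sgraph) : triangle_free G -> 9 <= #|G| -> 4 <= alpha G.
Proof.
move=> tf cG; have [//|aG] := leqP 4 (alpha G).
have deg (v : G) : #|nbrs v| = 3.
  apply/eqP; rewrite eqn_leq (leq_trans (degree_le_alpha v tf)) //=.
  have [//|dv] := leqP 3 #|nbrs v|.
  suff : 3 < alpha G by rewrite ltnNge -ltnS aG.
  apply: leq_trans (alpha_nonnbrs v); apply: ramsey33_alpha.
    exact: triangle_freeW (induced_isometric _) tf.
  rewrite card_induced; move: cG; rewrite (card_nbrs v) ltnS => h.
  by rewrite -(leq_add2l 2); apply: leq_trans h _; rewrite leq_add2r -ltnS.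
have c9 : #|G| = 9.
  apply/eqP; rewrite eqn_leq cG andbT leqNgt; apply/negP => c10.
  by have := ramsey_lt ramsey33_alpha tf c10; rewrite ltnNge -ltnS aG.
have := sum_degrees_even G; under eq_bigr do rewrite deg.
by rewrite sum_nat_const c9.
Qed.

End Ramsey.

(** * Gallai's lemma *)

Section Matchings.
Variable G : sgraph.
Implicit Types (f : {ffun G -> G}) (x y z : G).

(* A matching is encoded as the involution exchanging matched vertices. *)
Definition matching f : bool :=
  [forall x, (f (f x) == x) && ((f x == x) || adj x (f x))].

Definition missed f : {set G} := [set x | f x == x].

Lemma matchingP f : reflect
  (involutive f /\ forall x, f x != x -> adj x (f x)) (matching f).
Proof.
apply: (iffP forallP) => [h|[fK fa] x].
  split=> [x|x nx]; first by have /andP[/eqP] := h x.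
  by have /andP[_] := h x; rewrite (negPf nx).
by rewrite fK eqxx /=; case: eqVneq => //= /fa.
Qed.

(** Give each vertex weight 1, or 2 if it is missed; every class, a matched pair or a single missed
    vertex, then weighs 2. *)
Lemma card_blocks (C : finType) (c : G -> C) f : involutive f ->
  (forall x y, (c y == c x) = (y == x) || (y == f x)) ->
  2 * #|c @: [set: G]| = #|G| + #|missed f|.
Proof.
move=> fK cE; rewrite mulnC -sum_nat_const.
have -> : #|G| + #|missed f| = \sum_(x in [set: G]) (1 + (f x == x)).
  rewrite [RHS](eq_bigl predT) => [|x]; last by rewrite inE.
  rewrite big_split /= sum1_card; congr (_ + _).
  by rewrite -sum1dep_card big_mkcond.
rewrite (partition_big_imset c) /=; apply: eq_bigr => _ /imsetP[x _ ->].
have -> : \sum_(y in [set: G] | c y == c x) (1 + (f y == y))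
        = \sum_(y in [set x; f x]) (1 + (f y == y)).
  by apply: eq_bigl => y; rewrite cE !inE.
have [fx|fx] := eqVneq (f x) x; first by rewrite fx setUid big_set1 fx eqxx.
rewrite big_setU1 /=; last by rewrite inE eq_sym.
by rewrite big_set1 fK (negPf fx) eq_sym (negPf fx).
Qed.

Lemma matching_theta f : matching f -> 2 * theta G <= #|G| + #|missed f|.
Proof.
move=> /matchingP[fK fa].
rewrite -(card_blocks (c := fun x => [set x; f x]) fK) => [|x y].
  rewrite leq_mul2l; apply: theta_le_coloring => x y eq nxy.
  have : y \in [set x; f x] by rewrite eq !inE eqxx.
  by rewrite !inE eq_sym (negPf nxy) => /eqP yx; rewrite yx fa // -yx eq_sym.
apply/eqP/orP => [eq|[/eqP->//|/eqP->]]; last by rewrite fK setUC.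
have : y \in [set x; f x] by rewrite -eq !inE eqxx.
by rewrite !inE => /orP.
Qed.

(** Without triangles a color class has at most two vertices; [f] exchanges them, or fixes the only
    one. *)
Lemma coloring_matching (C : finType) (c : G -> C) (v : G) : triangle_free G ->
  clique_coloring c -> (forall x, c x = c v -> x = v) ->
  exists f, [/\ matching f, f v = v & #|G| + #|missed f| = 2 * #|c @: [set: G]|].
Proof.
move=> tf cc vc.
pose f := [ffun x => odflt x [pick y | (y != x) && (c y == c x)]].
have cf x : c (f x) = c x by rewrite ffunE; case: pickP => //= y /andP[_ /eqP].
have fE x y : c y = c x -> y != x -> y = f x.
  move=> cyx nyx; rewrite ffunE; case: pickP => [z /andP[nzx /eqP czx] /=|/(_ y)].
    apply/eqP/negPn/negP => nyz; apply: tf; exists x, y, z; split.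
    - by apply: cc => //; rewrite eq_sym.
    - by apply: cc => //; rewrite cyx.
    - by apply: cc => //; rewrite eq_sym.
  by rewrite nyx cyx eqxx.
have fK : involutive f.
  move=> x; have [eq|ne] := eqVneq (f x) x; first by rewrite !eq.
  by apply/esym/fE; rewrite ?cf // eq_sym.
exists f; split.
- by apply/matchingP; split=> // x nx; apply: cc; rewrite ?cf // eq_sym.
- by apply: vc; rewrite cf.
apply/esym/card_blocks => // x y.
apply/eqP/orP => [cyx|[]/eqP->] //; have [->|ne] := eqVneq y x; first by left.
by right; apply/eqP/fE.
Qed.

End Matchings.

Section Gallai.
Variable G : sgraph.
Hypothesis tf : triangle_free G.
Hypothesis critical : forall v : G, theta (induced [set~ v]) < theta G.
Implicit Types (f : {ffun G -> G}) (x y z : G).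

(** Equality in [matching_theta]: no matching misses fewer vertices. *)
Definition optimal f : bool := matching f && (#|G| + #|missed f| == 2 * theta G).

(** By criticality, the coloring that isolates [v] uses at most theta(G - v) + 1 <= theta(G)
    colors. *)
Lemma optimal_missing v : exists2 f, optimal f & f v = v.
Proof.
have [C [c [cc le vc]]] := theta_critical_coloring v.
have [f [mf fv eq]] := coloring_matching tf cc vc.
exists f => //; rewrite /optimal mf eqn_leq matching_theta // andbT eq leq_mul2l /=.
exact: leq_trans le (critical v).
Qed.

(** Gallai's relation: it contains the edges and is transitive, so connectedness extends it to all
    pairs. *)
Definition never_both x y : Prop := forall f, optimal f -> f x = x -> f y = y -> x = y.

Lemma never_both_adj x y : adj x y -> never_both x y.
Proof.
move=> axy f /andP[mf /eqP of_] fx fy; apply/eqP/negPn/negP => nxy.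
have /matchingP[fK fa] := mf.
(* [g] adds the edge [x y] to [f], contradicting optimality. *)
pose g := [ffun z => if z == x then y else if z == y then x else f z].
have fne z t : f t = t -> z != t -> f z != t.
  by move=> ft nz; apply: contra_neq nz => fz; rewrite -(fK z) fz ft.
have mg : matching g.
  apply/matchingP; split=> [z|z]; rewrite !ffunE.
    case: (eqVneq z x) => [->|nzx]; first by rewrite eqxx eq_sym (negPf nxy).
    case: (eqVneq z y) => [->|nzy]; first by rewrite eqxx.
    by rewrite (negPf (fne z x fx nzx)) (negPf (fne z y fy nzy)) fK.
  case: (eqVneq z x) => [-> //|nzx]; case: (eqVneq z y) => [-> _|nzy]; last exact: fa.
  by rewrite adj_sym.
have : #|missed g| < #|missed f|.
  apply/proper_card/properP; split.
    apply/subsetP => z; rewrite !inE ffunE; case: (eqVneq z x) => [->|_].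
      by rewrite fx eqxx.
    by case: (eqVneq z y) => [->|//]; rewrite fy eqxx.
  by exists x; rewrite !inE ?fx ?eqxx // ffunE eqxx eq_sym.
by rewrite -(ltn_add2l #|G|) of_ ltnNge matching_theta.
Qed.

(* Let M miss x and y, and let N miss z and agree with M as much as possible.  As
   N covers x and y, some w other than z is covered by M only, and replacing the
   N-edge at M w by the M-edge {w, M w} increases the agreement. *)
Lemma never_both_trans x z y : never_both x z -> never_both z y -> never_both x y.
Proof.
move=> xz zy M oM Mx My; apply/eqP/negPn/negP => nxy.
have nxz : x != z by apply: contra_neq nxy => eq; rewrite eq; apply: (zy M); rewrite -?eq.
have nyz : y != z by apply: contra_neq nxy => eq; rewrite eq; apply: (xz M); rewrite -?eq.
pose agree N := [set u | (M u == N u) && (M u != u)].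
have [N0 oN0 N0z] := optimal_missing z.
have [] := @arg_maxnP _ N0 (fun N => optimal N && (N z == z)) (fun N => #|agree N|).
  by rewrite oN0 N0z eqxx.
move=> N /andP[oN /eqP Nz] maxN.
have /andP[/matchingP[MK Ma] /eqP cM] := oM; have /andP[/matchingP[NK Na] /eqP cN] := oN.
have Nx : N x != x by apply: contra_neq nxz => Nx; apply: xz oN Nx Nz.
have Ny : N y != y by apply: contra_neq nyz => Ny; apply/esym; exact: (zy N).
have cMN : #|missed M| = #|missed N|.
  by apply/eqP; rewrite -(eqn_add2l #|G|) cM cN.
have [w nwz [Nw Mw]] : exists2 w, w != z & N w = w /\ M w != w.
  (* Optimal matchings miss equally many vertices, so [N] misses at least two vertices that [M]
     covers, and at most one of them is [z]. *)
  have : 1 < #|missed N :\: missed M|.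
    have -> : #|missed N :\: missed M| = #|missed M :\: missed N|.
      apply/eqP; rewrite -(eqn_add2l #|missed N :&: missed M|) cardsID -cMN setIC.
      by rewrite cardsID.
    have <- : #|[set x; y]| = 2 by rewrite cards2 nxy.
    apply/subset_leq_card/subsetP => u; rewrite !inE => /orP[]/eqP->.
      by rewrite Nx Mx eqxx.
    by rewrite Ny My eqxx.
  rewrite (cardsD1 z) => h.
  have /card_gt0P[w] : 0 < #|(missed N :\: missed M) :\ z|.
    by move: h; case: (z \in _) => //; rewrite add0n => /ltnW.
  by rewrite !inE => /and3P[nwz nMw /eqP Nw]; exists w.
pose t := M w; have awt : adj w t by apply: Ma.
(* [N] misses [w], so it cannot also miss the neighbor [t] of [w]. *)
have Nt : N t != t.
  by apply: contraNneq Mw => Nt; apply/eqP/esym; exact: (never_both_adj awt oN).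
pose s := N t.
have Ns : N s = t by apply: NK.
have nws : w != s by apply: contra_neq Mw => eq; rewrite -/t -Ns -eq Nw.
pose N' := [ffun u => if u == t then w else if u == w then t else if u == s then s else N u].
have ntw : t != w by [].
have nst : s != t by [].
have N't : N' t = w by rewrite ffunE eqxx.
have N'w : N' w = t by rewrite ffunE eqxx eq_sym (negPf ntw).
have N's : N' s = s by rewrite ffunE (negPf nst) eq_sym (negPf nws) eqxx.
have N'E u : u != t -> u != w -> u != s -> N' u = N u.
  by move=> /negPf h1 /negPf h2 /negPf h3; rewrite ffunE h1 h2 h3.
have mN' : matching N'.
  apply/matchingP; split=> u.
    have [->|ut] := eqVneq u t; first by rewrite N't N'w.
    have [->|uw] := eqVneq u w; first by rewrite N'w N't.
    have [->|us] := eqVneq u s; first by rewrite !N's.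
    rewrite !N'E ?NK //.
    - by apply: contra_neq us => eq; rewrite -(NK u) eq.
    - by apply: contra_neq uw => eq; rewrite -(NK u) eq.
    - by apply: contra_neq ut => eq; rewrite -(NK u) eq.
  have [->|ut] := eqVneq u t; first by rewrite N't adj_sym.
  have [->|uw] := eqVneq u w; first by rewrite N'w.
  have [->|us] := eqVneq u s; first by rewrite N's eqxx.
  by rewrite N'E //; apply: Na.
have missN' : missed N' = s |: (missed N :\ w).
  apply/setP => u; rewrite !inE.
  have [->|ut] := eqVneq u t.
    by rewrite N't (negPf Nt) andbF orbF !(eq_sym _ t) (negPf ntw) eq_sym (negPf nst).
  have [->|uw] := eqVneq u w; first by rewrite N'w (negPf ntw) (negPf nws).
  have [->|us] := eqVneq u s; first by rewrite N's eqxx.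
  by rewrite N'E.
have oN' : optimal N'.
  rewrite /optimal mN' missN' cardsU1 !inE Ns [t == s]eq_sym (negPf nst) andbF /=.
  rewrite -cN; have -> : #|missed N| = 1 + #|missed N :\ w|.
    by rewrite (cardsD1 w (missed N)) inE Nw eqxx.
  by [].
have N'z : N' z = z.
  rewrite N'E //; first by apply: contraNneq Nt => <-; rewrite Nz.
    by rewrite eq_sym.
  by apply: contraNneq nst => eq; rewrite -eq -{1}Nz eq Ns.
have := maxN N'; rewrite oN' N'z eqxx => /(_ isT) /=; rewrite leqNgt => /negP[].
(* Only [t], [w] and [s] change, and [M] and [N] disagree on all three, so no agreement is lost,
   while [w] is gained. *)
apply/proper_card/properP; split; last first.
  by exists w; rewrite !inE ?N'w ?eqxx ?Mw // Nw (negPf Mw).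
apply/subsetP => u; rewrite !inE => /andP[/eqP Mu nu].
rewrite nu andbT N'E ?Mu //.
- by apply: contra_neq nws => eq; rewrite /s -eq -Mu eq MK.
- by apply: contra_neq nu => eq; rewrite Mu eq Nw.
- apply: contra_neq nws => eq; have := Mu; rewrite eq Ns => Ms.
  by rewrite -(MK s) Ms MK.
Qed.

(** All pairs being related, an optimal matching that misses [v] misses nothing else. *)
Lemma gallai : (forall x y : G, connect (@adj G) x y) -> 2 * theta G <= #|G|.+1.
Proof.
move=> conn; have nb x y : never_both x y.
  have /connectP[p pp ->] := conn x y.
  elim: p x pp => [|z p IH] x /=; first by move=> _ f _ _ _.
  by move=> /andP[/never_both_adj xz /IH]; exact: never_both_trans.
have [c0|/card_gt0P[v _]] := posnP #|G|.
  by have := theta_le_card G; rewrite c0 leqn0 => /eqP->.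
have [f of_ fv] := optimal_missing v; have /andP[_ /eqP <-] := of_.
rewrite -addn1 leq_add2l -(cards1 v).
by apply/subset_leq_card/subsetP => x; rewrite !inE => /eqP fx; apply/eqP/(nb x v f).
Qed.

End Gallai.

(** * Enumeration *)

(* [has] and [all] are built from [||] and [&&], which do not short-circuit under
   call-by-value evaluation; these variants do. *)
Fixpoint existsb (A : Type) (p : A -> bool) (s : seq A) :=
  if s is x :: s' then if p x then true else existsb p s' else false.
Fixpoint forallb (A : Type) (p : A -> bool) (s : seq A) :=
  if s is x :: s' then if p x then forallb p s' else false else true.

Fixpoint map2 (op : bool -> bool -> bool) (m n : bitseq) : bitseq :=
  match m, n with
  | b :: m', c :: n' => op b c :: map2 op m' n'
  | _, _ => [::]
  end.

Fixpoint all_bits (m : nat) (P : bitseq -> bool) : bool :=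
  if m is m'.+1 then
    if all_bits m' (fun r => P (true :: r)) then all_bits m' (fun r => P (false :: r))
    else false
  else P [::].
Fixpoint all_rows (m : nat) (P : seq bitseq -> bool) : bool :=
  if m is m'.+1 then all_bits m' (fun r => all_rows m' (fun R => P (r :: R)))
  else P [::].
(* [P] holds of all nondecreasing sequences of length [m] with entries in [lo, 4). *)
Fixpoint all_sorted (m lo : nat) (P : seq nat -> bool) : bool :=
  if m is m'.+1 then
    forallb (fun c => all_sorted m' c (fun l => P (c :: l))) (iota lo (4 - lo))
  else P [::].

(* Graphs are encoded by the rows of the upper triangle of their adjacency matrix,
   see [rows]; [m] is the set of vertices that may still be chosen. *)
Fixpoint max_homog (b : bool) (R : seq bitseq) (m : bitseq) : nat :=
  match R, m with
  | r :: R', c :: m' =>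
      if c then
        let i := (max_homog b R' (map2 (fun x y => x && (y == b)) m' r)).+1 in
        let j := max_homog b R' m' in if i < j then j else i
      else max_homog b R' m'
  | _, _ => 0
  end.

Fixpoint stable_masks (R : seq bitseq) (m : bitseq) (k : nat) : seq bitseq :=
  match R, m with
  | r :: R', c :: m' =>
      (if c then
         if k is k'.+1 then
           map (cons true) (stable_masks R' (map2 (fun x y => x && ~~ y) m' r) k')
         else [::]
       else [::]) ++ map (cons false) (stable_masks R' m' k)
  | _, _ => if k is 0 then [:: [::]] else [::]
  end.

(** The vertex with row [r] is the head column of every mask. There is one result for each clique
    that can take it, and that clique keeps only the common later neighbors. *)
Fixpoint joins (r : bitseq) (ms : seq bitseq) : seq (seq bitseq) :=
  if ms is m :: ms' then
    (if head false m then [:: map2 andb r (behead m) :: map behead ms'] else [::])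
    ++ map (cons (behead m)) (joins r ms')
  else [::].

(* Each mask in [ms] stands for a clique under construction and lists the vertices
   to come that are adjacent to all of it.  The [q] columns beyond the triangle
   are constraints: in the end, each must be satisfied by all of some clique. *)
Fixpoint coverable (q : nat) (R : seq bitseq) (ms : seq bitseq) (k : nat) : bool :=
  if R is r :: R' then
    if existsb (fun ms' => coverable q R' ms' k) (joins r ms) then true
    else if k is k'.+1 then coverable q R' (r :: map behead ms) k' else false
  else forallb (fun j => existsb (fun m => nth false m j) ms) (iota 0 q).

Fixpoint hits (M S : bitseq) : bool :=
  match M, S with
  | b :: M', c :: S' => if (if b then c else false) then true else hits M' S'
  | _, _ => false
  end.
Fixpoint sub_bits (M S : bitseq) : bool :=
  match M, S with
  | b :: M', c :: S' => if (if b then c else true) then sub_bits M' S' else false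
  | [::], [::] => true
  | _, _ => false
  end.
Fixpoint hit_extensions (M S : bitseq) : seq bitseq :=
  match M, S with
  | b :: M', c :: S' =>
      (if c then [:: true :: M'] else [::]) ++ map (cons b) (hit_extensions M' S')
  | _, _ => [::]
  end.
(** The pruning step of Berge's construction of minimal transversals, which treats the sets to be
    met one at a time. *)
Definition insert_minimal (L : seq bitseq) (M : bitseq) : seq bitseq :=
  if existsb (fun M' => sub_bits M' M) L then L
  else M :: filter (fun M' => ~~ sub_bits M M') L.
(* The inclusion-minimal sets meeting all members of [Ss]. *)
Fixpoint transversals (n : nat) (Ss : seq bitseq) : seq bitseq :=
  if Ss is S0 :: Ss' then
    foldl insert_minimal [::]
      (flatten (map (fun M => if hits M S0 then [:: M] else hit_extensions M S0)
                    (transversals n Ss')))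
  else [:: nseq n false].

Fixpoint glue (R Ms : seq bitseq) : seq bitseq :=
  if R is r :: R' then (r ++ map (head false) Ms) :: glue R' (map behead Ms)
  else [::].
(** The masks [Ms] become constraint columns: each must contain one of the at most [k] cliques
    covering the graph. *)
Definition absorbs (R : seq bitseq) (Ms : seq bitseq) (k : nat) :=
  coverable (size Ms) (glue R Ms) [::] k.

(* [R] encodes F = G - T for a triangle T, and a = alpha(F).  If alpha(G) = a then
   each vertex of T is adjacent to a transversal of the stable a-sets of F, and a
   cover of F by a + 1 cliques extends to T once each of these transversals
   contains one of its cliques.  Both conditions are monotone, so that only
   minimal transversals matter. *)
Definition tri_check (R : seq bitseq) : bool :=
  let n := size R in
  let a := max_homog false R (nseq n true) in
  (* A cover of F by a cliques, together with T, covers G by a + 1. *)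
  if coverable 0 R [::] a then true
  else if coverable 0 R [::] a.+1 then
    let L := transversals n (stable_masks R (nseq n true) a) in
    (* Sufficient condition tried before the triples: one cover serving all minimal transversals at
       once. *)
    if absorbs R L a.+1 then true
    else forallb (fun M1 => forallb (fun M2 => forallb (fun M3 =>
           absorbs R [:: M1; M2; M3] a.+1) L) L) L
  else false.

(* The first two vertices are nonadjacent, and the code c in l of another vertex
   is the sum of 1 and 2 according to its adjacency to the first and the second. *)
Definition two_rows (l : seq nat) (R : seq bitseq) : seq bitseq :=
  (false :: map odd l) :: map (fun c => 1 < c) l :: R.
(** There are 56 sorted sequences of five codes and 2^10 graphs on the five other vertices, hence
    57344 cases instead of 2^21. *)
Lemma tri_check7 :
  all_sorted 5 0 (fun l => all_rows 5 (fun R => tri_check (two_rows l R))).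
Proof. by vm_compute. Qed.

(** * Correctness of the enumeration *)

Lemma existsbE (A : Type) (p : A -> bool) s : existsb p s = has p s.
Proof. by elim: s => //= x s ->; case: (p x). Qed.

Lemma forallbE (A : Type) (p : A -> bool) s : forallb p s = all p s.
Proof. by elim: s => //= x s ->; case: (p x). Qed.

Lemma all_bitsP m P : all_bits m P -> forall r, size r = m -> P r.
Proof.
elim: m P => [|m IH] P /=; first by move=> h [].
case: ifP => // h1 h2 [//|[] r] /= [sz]; [exact: IH h1 _ sz | exact: IH h2 _ sz].
Qed.

Lemma all_sortedP m lo P : all_sorted m lo P ->
  forall l, size l = m -> path leq lo l -> all (fun c => c < 4) l -> P l.
Proof.
elim: m lo P => [|m IH] lo P /=; first by move=> h [].
rewrite forallbE => /allP h [//|c l] /= [sz] /andP[lc pl] /andP[c4 l4].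
apply: (IH c (fun l => P (c :: l))) => //; apply: h.
by rewrite mem_iota lc subnKC // (leq_trans lc) // ltnW.
Qed.

Section Rows.
Variable G : sgraph.
Implicit Types (s : seq G) (Ps : seq (pred G)).

Fixpoint rows s Ps : seq bitseq :=
  if s is x :: s' then
    ([seq adj x y | y <- s'] ++ [seq P x | P : pred G <- Ps]) :: rows s' Ps
  else [::].

Lemma size_rows s Ps : size (rows s Ps) = size s.
Proof. by elim: s => //= x s ->. Qed.

Lemma all_rowsP m P : all_rows m P -> forall s, size s = m -> P (rows s [::]).
Proof.
elim: m P => [|m IH] P /=; first by move=> h [].
move=> /all_bitsP h [//|x s] /= [sz]; rewrite cats0.
by apply: (IH (fun R => P (_ :: R))) => //; apply: h; rewrite size_map.
Qed.

Lemma map2_map (T : Type) op (f g : T -> bool) (s : seq T) :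
  map2 op (map f s) (map g s) = [seq op (f x) (g x) | x <- s].
Proof. by elim: s => //= x s ->. Qed.

Lemma map2_cat op m1 m2 n1 n2 : size m1 = size n1 ->
  map2 op (m1 ++ m2) (n1 ++ n2) = map2 op m1 n1 ++ map2 op m2 n2.
Proof. by elim: m1 n1 => [|b m1 IH] [|c n1] //= [/IH ->]. Qed.

Lemma homog_cons b x s : homog b s -> {in s, forall y, adj x y = b} ->
  homog b (x :: s).
Proof.
move=> hs hx y z; rewrite !inE => /orP[/eqP->|ys] /orP[/eqP->|zs].
- by rewrite eqxx.
- by move=> _; apply: hx.
- by move=> _; rewrite adj_sym; apply: hx.
- exact: hs.
Qed.

Lemma nseq_predT s : nseq (size s) true = map (predT : pred G) s.
Proof. by elim: s => //= x s ->. Qed.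

Lemma max_homog_sound b s (p : pred G) : uniq s ->
  exists t : seq G, [/\ uniq t, {subset t <= [seq x <- s | p x]}, homog b t
    & size t = max_homog b (rows s [::]) (map p s)].
Proof.
elim: s p => [|x s IH] p /=; first by exists [::].
rewrite cats0 => /andP[xs us].
have [t0 [ut0 sub0 h0 sz0]] := IH p us; case: ifP => px; last first.
  by exists t0; split.
have sub1 : {subset t0 <= x :: [seq x <- s | p x]}.
  by move=> y /sub0; rewrite inE => ->; rewrite orbT.
rewrite map2_map; have [t1 [ut1 sub' h1 sz1]] := IH (fun y => p y && (adj x y == b)) us.
case: ifP => _; first by exists t0; split.
have sub1' y : y \in t1 -> [/\ y \in s, p y & adj x y = b].
  by move=> /sub'; rewrite mem_filter => /andP[/andP[-> /eqP ->] ->].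
exists (x :: t1); split=> /=; last by rewrite sz1.
- by rewrite ut1 andbT; apply/negP => /sub1'[xs' _ _]; rewrite xs' in xs.
- move=> y; rewrite !inE => /orP[->//|/sub1'[ys py _]].
  by rewrite mem_filter py ys orbT.
- by apply: homog_cons => // y /sub1'[].
Qed.

Lemma max_homog_complete b s (p : pred G) (t : seq G) : uniq t ->
  {subset t <= [seq x <- s | p x]} -> homog b t ->
  size t <= max_homog b (rows s [::]) (map p s).
Proof.
elim: s p t => [|x s IH] p t ut sub ht /=.
  by case: t {ut ht} sub => // y t /(_ y (mem_head _ _)).
rewrite cats0; case: ifP => px; last first.
  by apply: IH => // y /sub; rewrite /= px.
rewrite map2_map; set i := max_homog b _ _; set j := max_homog b _ (map p s).
have [xt|xt] := boolP (x \in t); last first.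
  have le : size t <= j.
    apply: IH => // y yt; have := sub y yt; rewrite /= px inE => /orP[/eqP eq|//].
    by rewrite -eq yt in xt.
  by apply: leq_trans le _; case: (ltnP i.+1 j).
have le : size t <= i.+1.
  have /(perm_size (s1 := t)) -> := perm_to_rem xt; rewrite ltnS.
  apply: (IH (fun y => p y && (adj x y == b))); first exact: rem_uniq.
    move=> y; rewrite (mem_rem_uniq _ ut) !inE => /andP[nyx yt].
    have := sub y yt; rewrite /= px inE (negPf nyx) !mem_filter /= => /andP[-> ->].
    by rewrite andbT ht ?eqxx // eq_sym.
  by move=> y z /mem_rem yt /mem_rem zt; apply: ht.
by apply: leq_trans le _; case: (ltnP i.+1 j) => // /ltnW.
Qed.

Lemma stable_masks_sound s (p : pred G) k S : S \in stable_masks (rows s [::]) (map p s) k ->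
  [/\ size S = size s, size (mask S s) = k, all p (mask S s) & homog false (mask S s)].
Proof.
elim: s p k S => [|x s IH] p k S /=.
  by case: k => // ; rewrite inE => /eqP ->; split.
rewrite cats0 mem_cat => /orP[].
  case: ifP => // px; case: k => // k; rewrite map2_map => /mapP[S' S'in ->].
  have [sz szm al ho] := IH (fun y => p y && ~~ adj x y) _ _ S'in.
  split=> /=; rewrite ?sz ?szm ?px //; first by apply: sub_all al => y /andP[].
  by apply: homog_cons => // y /(allP al)/andP[_ /negPf].
by move=> /mapP[S' /IH[sz szm al ho] ->]; split; rewrite //= sz.
Qed.

Lemma not_hits_map S s (f : pred G) : ~~ hits (map f s) S ->
  {in mask S s, forall y, f y = false}.
Proof.
elim: s S => [|x s IH] [|c S] //=; case fx: (f x) => /=.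
  by case: c => //= /IH.
case: c => /= /IH h y; last exact: h.
by rewrite inE => /orP[/eqP->|/h].
Qed.

(* The mask of the clique [B] in the sense of [coverable]. *)
Definition block_bits s Ps (B : seq G) : bitseq :=
  [seq all (adj y) B | y <- s] ++ [seq all P B | P : pred G <- Ps].

Lemma joins_sound x s Ps Bs ms :
  ms \in joins ([seq adj x y | y <- s] ++ [seq P x | P : pred G <- Ps])
           (map (block_bits (x :: s) Ps) Bs) ->
  exists Bs1 B Bs2, [/\ Bs = Bs1 ++ B :: Bs2, all (adj x) B
    & ms = map (block_bits s Ps) (Bs1 ++ (x :: B) :: Bs2)].
Proof.
have bh : map behead (map (block_bits (x :: s) Ps) Bs) = map (block_bits s Ps) Bs.
  by rewrite -map_comp.
elim: Bs ms {bh} => [|B Bs IH] ms //=; rewrite mem_cat => /orP[].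
  case: ifP => // xB; rewrite inE => /eqP ->; exists [::], B, Bs; split=> //=.
  rewrite -map_comp; congr (_ :: _); rewrite /block_bits map2_cat ?size_map // !map2_map.
  by congr (_ ++ _); apply: eq_map => y /=; rewrite adj_sym.
move=> /mapP[ms' /IH[Bs1 [B' [Bs2 [-> xB ->]]]] ->].
by exists (B :: Bs1), B', Bs2.
Qed.

(** Induction on [s]: each vertex joins a clique under construction or starts a new one, paid for by
    [k]. At the end the masks have shrunk to the constraint columns. *)
Lemma coverable_sound s Ps Bs k :
  (forall B, B \in Bs -> homog true B) ->
  coverable (size Ps) (rows s Ps) (map (block_bits s Ps) Bs) k ->
  exists Bs' : seq (seq G), [/\ size Bs' <= size Bs + k,
    forall B, B \in Bs' -> homog true B,
    forall x, (x \in s) || has (fun B => x \in B) Bs -> has (fun B => x \in B) Bs'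
    & forall i, i < size Ps -> has (all (nth xpred0 Ps i)) Bs'].
Proof.
elim: s Bs k => [|x s IH] Bs k hBs /=.
  rewrite forallbE => /allP h; exists Bs; split=> // [|i iP]; first exact: leq_addr.
  have := h i; rewrite mem_iota => /(_ iP); rewrite existsbE has_map => /hasP[B BB].
  by rewrite /= (nth_map xpred0) // => nB; apply/hasP; exists B.
case: ifP => [|_].
  rewrite existsbE => /hasP[ms /joins_sound[Bs1 [B [Bs2 [eqB xB ->]]]]].
  case/IH => [B'|Bs' [sz hB' cB' hP]].
    have hB : homog true B by apply: hBs; rewrite eqB mem_cat mem_head orbT.
    rewrite mem_cat inE => /or3P[B1|/eqP->|B2].
    - by apply: hBs; rewrite eqB mem_cat B1.
    - by apply: homog_cons => // y /(allP xB).
    - by apply: hBs; rewrite eqB mem_cat inE B2 !orbT.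
  exists Bs'; split=> //; first by rewrite eqB; move: sz; rewrite !size_cat.
  move=> y; rewrite eqB has_cat /= inE => h; apply: cB'; rewrite has_cat /= inE.
  by case: (y == x) h => /=; case: (y \in s); case: (y \in B); case: (has _ _).
case: k => // k; have -> : ([seq adj x y | y <- s] ++ [seq P x | P : pred G <- Ps])
    :: map behead (map (block_bits (x :: s) Ps) Bs)
    = map (block_bits s Ps) ([:: x] :: Bs).
  rewrite -map_comp /=; congr (_ :: _); rewrite /block_bits /=.
  by congr (_ ++ _); apply: eq_map => y; rewrite /= andbT // adj_sym.
case/IH => [B'|Bs' [sz hB' cB' hP]].
  by rewrite inE => /orP[/eqP->|/hBs//] y z; rewrite !inE => /eqP-> /eqP->; rewrite eqxx.
exists Bs'; split=> //; first by move: sz; rewrite /= addSnnS.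
by move=> y; rewrite inE => h; apply: cB'; move: h; rewrite /= inE orbA [(y == x) || _]orbC.
Qed.

Lemma glue_rows s L Ps : uniq s ->
  {in s, forall x, [seq P x | P : pred G <- Ps] = [seq nth false M (index x s) | M <- L]} ->
  glue (rows s [::]) L = rows s Ps.
Proof.
elim: s L => [|x s IH] L //= /andP[xs us] h; rewrite cats0 h ?mem_head //= eqxx.
congr (_ :: _).
apply: IH => // y ys; rewrite h ?inE ?ys ?orbT // -map_comp; apply: eq_map => M /=.
by rewrite nth_behead; case: eqP ys xs => [-> ->|].
Qed.

End Rows.

Lemma sub_bits_trans M N K : sub_bits M N -> sub_bits N K -> sub_bits M K.
Proof.
elim: M N K => [|b M IH] [|c N] // [|d K] //=.
by case: b; case: c; case: d => //=; apply: IH.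
Qed.

Lemma sub_bits_nseq n N : size N = n -> sub_bits (nseq n false) N.
Proof. by move=> <-; elim: N. Qed.

Lemma sub_bits_nth M N i : sub_bits M N -> nth false M i -> nth false N i.
Proof.
elim: M N i => [|b M IH] [|c N] [|i] //=; first by case: b; case: c.
by case: b; case: c => //=; apply: IH.
Qed.

Lemma hit_extensions_sub M N S0 : sub_bits M N -> hits N S0 ->
  exists2 M', M' \in hit_extensions M S0 & sub_bits M' N.
Proof.
elim: M N S0 => [|b M IH] [|c N] [|d S0] //=.
case: ifP => // bc sMN; case: ifP => [|_ /(IH _ _ sMN)[M' M'in sM']].
  by case: c bc => // _ dt _; exists (true :: M) => //; rewrite dt mem_head.
exists (b :: M'); last by rewrite /= bc.
by rewrite mem_cat map_f // orbT.
Qed.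

(** A set inside [N] is discarded only in favor of one of its own subsets, which is again inside
    [N]. *)
Lemma foldl_insert_minimal_sub N Ms L : has (fun M => sub_bits M N) (L ++ Ms) ->
  has (fun M => sub_bits M N) (foldl insert_minimal L Ms).
Proof.
elim: Ms L => [|M Ms IH] L /=; first by rewrite cats0.
move=> h; apply: IH; move: h; rewrite !has_cat /=.
case: (has _ Ms); rewrite ?orbT // !orbF /insert_minimal existsbE.
case: ifP => [/hasP[M' M'L sM] /orP[//|sN]|_ /orP[]].
- by apply/hasP; exists M' => //; apply: sub_bits_trans sM sN.
- case/hasP => M' M'L sN /=; case sMN: (sub_bits M N) => //=; apply/hasP; exists M' => //.
  by rewrite mem_filter M'L andbT; apply: contraFN sMN => /sub_bits_trans; apply.
- by move=> /= ->.
Qed.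

(** A listed set inside [N] that meets all of [Ss] either meets [S0] as well or is enlarged by an
    element that [N] shares with [S0]. *)
Lemma transversals_sub n Ss N : size N = n -> all (hits N) Ss ->
  exists2 M, M \in transversals n Ss & sub_bits M N.
Proof.
move=> sN; elim: Ss => [_|S0 Ss IH /= /andP[hS /IH[M Min sM]]].
  by exists (nseq n false); rewrite ?mem_head ?sub_bits_nseq.
apply/hasP/foldl_insert_minimal_sub => /=; apply/hasP.
case hM: (hits M S0).
  exists M => //; apply/flattenP; exists [:: M]; rewrite ?mem_head //.
  by apply/mapP; exists M; rewrite ?hM.
have [M' M'in sM'] := hit_extensions_sub sM hS; exists M' => //.
by apply/flattenP; exists (hit_extensions M S0) => //; apply/mapP; exists M; rewrite ?hM.
Qed.

Section Enumeration.
Variable G : sgraph.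

Lemma sorted_enumeration m (P : seq bitseq -> bool) (u : seq G) (v w : G) :
  all_sorted m 0 (fun l => all_rows m (fun R => P (two_rows l R))) ->
  uniq u -> size u = m.+2 -> v \in u -> w \in u -> v != w -> ~~ adj v w ->
  exists2 s : seq G, perm_eq s u & P (rows s [::]).
Proof.
move=> all_P uu su vu wu neq nadj.
(* [odd (c x)] recovers [adj v x] and [1 < c x] recovers [adj w x], which is how [two_rows]
   decodes. *)
pose c x := adj v x + 2 * adj w x.
pose t := rem w (rem v u); pose s := sort (fun x y => c x <= c y) t.
have pu : perm_eq u (v :: w :: t).
  rewrite (perm_trans (perm_to_rem vu)) // perm_cons perm_to_rem //.
  by rewrite (mem_rem_uniq _ uu) !inE eq_sym neq.
have ss : size s = m.
  by have := perm_size pu; rewrite su size_sort /= => -[->].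
have ps : perm_eq (v :: w :: s) u.
  by rewrite perm_sym (perm_trans pu) // !perm_cons perm_sym perm_sort.
exists (v :: w :: s) => //=; rewrite !cats0 (negPf nadj).
have := all_sortedP all_P (l := map c s); rewrite size_map => /(_ ss).
have pc : path leq 0 (map c s).
  have : sorted leq (map c s).
    by rewrite sorted_map; apply: sort_sorted => x y; exact: leq_total.
  by case: (map c s).
have c4 : all (fun k => k < 4) (map c s).
  by apply/allP => _ /mapP[x _ ->]; rewrite /c; case: adj; case: adj.
move=> /(_ pc c4)/all_rowsP/(_ _ ss); rewrite /two_rows -!map_comp.
congr (P ((_ :: _) :: _ :: _)); apply: eq_map => x; rewrite /= /c.
  by case: adj; case: adj.
by case: adj; case: adj.
Qed.

Lemma tri_check_sound (T s : seq G) : size T = 3 -> uniq (T ++ s) -> homog true T ->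
  (forall x, x \in T ++ s) -> tri_check (rows s [::]) -> gap G <= 1.
Proof.
move=> sT uTs hT full; have us : uniq s by move: uTs; rewrite cat_uniq => /and3P[].
rewrite /tri_check size_rows nseq_predT.
have [st [ust _ hst szst]] := max_homog_sound false predT us.
set a := max_homog _ _ _ in szst *.
have aG : a <= alpha G by rewrite -szst homog_alpha.
have cover_T k : coverable 0 (rows s [::]) [::] k -> theta G <= k.+1.
  move=> /(coverable_sound (Ps := [::]) (Bs := [::]))[//|Bs [sz hB cB _]].
  apply: leq_trans (theta_le_cover (Bs := T :: Bs) _ _) _ => //.
    by move=> B; rewrite inE => /orP[/eqP->|/hB].
  move=> x /=; have := full x; rewrite mem_cat => /orP[->//|xs].
  by rewrite cB ?orbT // xs.
case: ifP => [/cover_T le _|_]; first by apply: gap_le; rewrite addn1 (leq_trans le).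
case: ifP => // /cover_T le2; set L := transversals _ _ => chk.
(* If alpha(G) exceeds [a], the cover of size [a] + 2 already gives gap at most 1. *)
have [aG'|aG'] := ltnP a (alpha G).
  by apply: gap_le; rewrite addn1 (leq_trans le2).
(* A stable [a]-set disjoint from the neighborhood of [t] would grow by [t] beyond alpha(G). *)
have hitL t : t \in T -> exists2 M, M \in L & sub_bits M [seq adj t y | y <- s].
  move=> tT; apply: transversals_sub; first by rewrite size_map.
  apply/allP => S0 /stable_masks_sound[_ sz _ ho]; apply/negPn/negP => /not_hits_map nh.
  have : size (t :: mask S0 s) <= alpha G.
    apply: homog_alpha; last exact: homog_cons.
    rewrite /= mask_uniq // andbT; apply: contraTN uTs => /mem_mask ts.
    rewrite cat_uniq; apply/negP => /and3P[_ /hasPn/(_ t ts)].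
    by rewrite tT.
  by rewrite /= sz ltnNge aG'.
have absorb Ms : absorbs (rows s [::]) Ms a.+1 ->
    {in T, forall t, exists2 M, M \in Ms & sub_bits M [seq adj t y | y <- s]} ->
    theta G <= a.+1.
  pose Ps : seq (pred G) := [seq (fun x => nth false M (index x s)) | M <- Ms].
  have sP : size Ps = size Ms by rewrite size_map.
  rewrite /absorbs -sP.
  rewrite (glue_rows (Ps := Ps)) //; last by move=> x _; rewrite /Ps -map_comp.
  move=> chP hTM; have [//|Bs [sz hB cB hP]] := coverable_sound (Bs := [::]) _ chP.
  have hTB t : t \in T -> has (all (adj t)) Bs.
    move=> tT; have [M MM sM] := hTM t tT.
    have := hP (index M Ms); rewrite sP index_mem => /(_ MM).
    rewrite (nth_map [::]) ?index_mem // nth_index // => /hasP[B BB aB].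
    apply/hasP; exists B => //; apply: sub_all aB => x /(sub_bits_nth sM).
    have [xs|xs] := boolP (x \in s).
      by rewrite (nth_map x) ?index_mem // nth_index.
    (* Outside [s] the index is [size s], where [nth] returns its default [false]. *)
    by rewrite nth_default // size_map memNindex.
  rewrite -(add0n a.+1); apply: leq_trans sz.
  (* Each clique [B] takes in all vertices of [T] complete to it and remains a clique because [T] is
     one; [theta_le_cover] tolerates the overlaps. *)
  rewrite -(size_map (fun B => B ++ [seq t <- T | all (adj t) B])).
  apply: theta_le_cover => [_ /mapP[B /hB hoB ->] x y|x].
    rewrite !mem_cat !mem_filter => /orP[xB|/andP[xB xT]] /orP[yB|/andP[yB yT]] nxy.
    - exact: hoB.
    - by rewrite adj_sym (allP yB).
    - exact: (allP xB).
    - exact: hT.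
  rewrite has_map; have := full x; rewrite mem_cat => /orP[xT|xs].
    have /hasP[B BB aB] := hTB x xT; apply/hasP; exists B => //=.
    by rewrite mem_cat mem_filter aB xT orbT.
  have /hasP[B BB xB] : has (fun B => x \in B) Bs by rewrite cB // xs.
  by apply/hasP; exists B => //=; rewrite mem_cat xB.
suff le : theta G <= a.+1 by apply: gap_le; rewrite addn1 (leq_trans le).
move: chk; case: ifP => [/absorb h _|_]; first exact: h.
case: T sT hitL absorb {uTs hT full cover_T} => [//|t1 [//|t2 [//|t3 []]]] // _ hitL absorb.
have [M1 L1 s1] := hitL t1 (mem_head _ _).
have [M2 L2 s2] : exists2 M, M \in L & sub_bits M [seq adj t2 y | y <- s].
  by apply: hitL; rewrite !inE eqxx orbT.
have [M3 L3 s3] : exists2 M, M \in L & sub_bits M [seq adj t3 y | y <- s].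
  by apply: hitL; rewrite !inE eqxx !orbT.
rewrite forallbE => /allP/(_ _ L1); rewrite forallbE => /allP/(_ _ L2).
rewrite forallbE => /allP/(_ _ L3)/absorb; apply=> t.
rewrite !inE => /or3P[]/eqP->; first by exists M1; rewrite ?mem_head.
  by exists M2; rewrite // !inE eqxx orbT.
by exists M3; rewrite // !inE eqxx !orbT.
Qed.

Lemma gap_triangle10 : #|G| = 10 -> ~ triangle_free G -> gap G <= 1.
Proof.
move=> c10 ntf; case: leqP => // gap2; case: ntf => -[t1 [t2 [t3 [a12 a23 a13]]]].
have neq x y : adj x y -> x != y by apply: contraTneq => ->; rewrite adj_irr.
pose T := [:: t1; t2; t3]; pose u := [seq x <- enum G | x \notin T].
have uT : uniq T by rewrite /= !inE !negb_or !neq.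
have hT : homog true T.
  move=> x y; rewrite !inE => /or3P[]/eqP-> /or3P[]/eqP->; rewrite ?eqxx //.
  - by rewrite adj_sym.
  - by rewrite adj_sym.
  - by rewrite adj_sym.
have uu : uniq u by rewrite filter_uniq // enum_uniq.
have memu x : (x \in u) = (x \notin T) by rewrite mem_filter mem_enum andbT.
have uTu : uniq (T ++ u).
  by rewrite cat_uniq uT uu andbT; apply/hasPn => x; rewrite memu.
have full x : x \in T ++ u by rewrite mem_cat memu orbN.
have su : size u = 7.
  have : size (T ++ u) = 10.
    by rewrite -(card_uniqP uTu) -c10; apply: eq_card => x; rewrite full.
  by rewrite size_cat /= => -[].
(* If G - T is complete, it and [T] cover G by two cliques; otherwise there is a nonadjacent pair to
   put first. *)
have [hu|/allPn[v vu /allPn[w wu]]] :=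
  boolP (all (fun x => all (fun y => (x != y) ==> adj x y) u) u).
  move: gap2; rewrite ltnNge => /negP[]; apply: gap_le.
  apply: leq_trans (theta_le_cover (Bs := [:: T; u]) _ _) _.
  - move=> B; rewrite !inE => /orP[]/eqP-> // x y xu yu nxy.
    by have /allP/(_ y yu) := allP hu x xu; rewrite nxy.
  - by move=> x; rewrite /= orbF -mem_cat.
  - rewrite /= addn1 ltnS; apply: leq_trans (homog_alpha (s := [:: t1]) _ _) => //.
    by move=> x y; rewrite !inE => /eqP-> /eqP->; rewrite eqxx.
rewrite negb_imply => /andP[vw nvw].
have [s ps ck] := sorted_enumeration tri_check7 uu su vu wu vw nvw.
rewrite ltnNge in gap2; case/negP: gap2; apply: (tri_check_sound (T := T) (s := s)) => //.
  by rewrite (perm_uniq (_ : perm_eq _ (T ++ u))) // perm_cat2l.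
by move=> x; rewrite mem_cat (perm_mem ps) -mem_cat.
Qed.

End Enumeration.

(** * Recognition of small graphs up to isomorphism *)

Definition entry (R : seq bitseq) (i j : nat) : bool :=
  if i < j then nth false (nth [::] R i) (j - i.+1)
  else nth false (nth [::] R j) (i - j.+1).

(** As long as [p] has no repetition the diagonal is never read, where [entry] returns a meaningless
    bit. *)
Fixpoint permute_rows (R : seq bitseq) (p : seq nat) : seq bitseq :=
  if p is i :: p' then [seq entry R i j | j <- p'] :: permute_rows R p' else [::].

Definition gap_check (Q R : seq bitseq) : bool :=
  let n := size R in
  if coverable 0 R [::] (max_homog false R (nseq n true)) then true
  else existsb (fun p => permute_rows R p == Q) (permutations (iota 0 n)).

Section Entries.
Variable G : sgraph.

Lemma rows_nth (x0 : G) s i j : i < j -> j < size s ->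
  nth false (nth [::] (rows s [::]) i) (j - i.+1) = adj (nth x0 s i) (nth x0 s j).
Proof.
elim: s i j => [|x s IH] [|i] [|j] //= ij js; last by rewrite subSS IH.
by rewrite cats0 subn1 (nth_map x0).
Qed.

Lemma entry_rows (x0 : G) s i j : i != j -> i < size s -> j < size s ->
  entry (rows s [::]) i j = adj (nth x0 s i) (nth x0 s j).
Proof.
rewrite /entry; case: (ltngtP i j) => // ij _ si sj; first exact: (rows_nth x0 ij sj).
by rewrite (rows_nth x0 ij si) adj_sym.
Qed.

Lemma permute_rowsE (x0 : G) s p : uniq p -> all (fun i => i < size s) p ->
  permute_rows (rows s [::]) p = rows (map (nth x0 s) p) [::].
Proof.
elim: p => [|i p IH] //= /andP[ip up] /andP[is_ ps]; rewrite IH // cats0; congr (_ :: _).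
rewrite -map_comp; apply/eq_in_map => j jp /=; apply: entry_rows => //.
  by apply: contraNneq ip => ->.
exact: (allP ps).
Qed.

End Entries.

Lemma rows_iso (G H : sgraph) (y0 : H) (s : seq G) (t : seq H) : uniq s -> uniq t ->
  (forall x, x \in s) -> (forall y, y \in t) ->
  rows s [::] = rows t [::] -> iso G H.
Proof.
move=> us ut fs ft eq.
have st : size s = size t by rewrite -(size_rows s [::]) eq size_rows.
have [c0|/card_gt0P[x0 _]] := posnP #|G|.
  case: s st us eq fs => [|x s]; last by have := card0_eq c0 x.
  by move=> /esym/size0nil t0; have := ft y0; rewrite t0.
have ix x : index x s < size t by rewrite -st index_mem.
exists (fun x => nth y0 t (index x s)); split.
  exists (fun y => nth x0 s (index y t)) => [x|y].
    by rewrite index_uniq // nth_index.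
  by rewrite index_uniq ?nth_index // st index_mem.
move=> x y; have [->|nxy] := eqVneq x y; first by rewrite !adj_irr.
have nij : index x s != index y s.
  by apply: contra_neq nxy => e; rewrite -(nth_index x0 (fs x)) e nth_index.
have := entry_rows (s := s) x0 nij; rewrite !index_mem !nth_index // => <- //.
by rewrite eq (entry_rows y0).
Qed.

Lemma uniq_full (G : sgraph) (s : seq G) : uniq s -> size s = #|G| -> forall x, x \in s.
Proof.
move=> us sz x; have : #|s| = #|G| by rewrite (card_uniqP us).
by move=> e; rewrite (subset_cardP e (subset_predT _)).
Qed.

Section GapCheck.
Variable G : sgraph.

Lemma coverable_theta (s : seq G) (k : nat) : uniq s -> size s = #|G| ->
  coverable 0 (rows s [::]) [::] k -> theta G <= k.
Proof.
move=> us sz /(coverable_sound (Ps := [::]) (Bs := [::]))[//|Bs [szB hB cB _]].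
apply: leq_trans szB; apply: theta_le_cover => // x; apply: cB.
by rewrite uniq_full.
Qed.

Lemma gap_check_sound (H : sgraph) (y0 : H) (s : seq G) (t : seq H) :
  uniq s -> size s = #|G| -> uniq t -> size t = #|H| ->
  gap_check (rows t [::]) (rows s [::]) -> 0 < gap G -> iso G H.
Proof.
move=> us szs ut szt; rewrite /gap_check size_rows nseq_predT.
have fs := uniq_full us szs; have ft := uniq_full ut szt.
have [st [ust _ hst <-]] := max_homog_sound false predT us.
case: ifP => [|_].
  move=> /(coverable_theta us szs) le _; rewrite ltnNge; case/negP; apply: gap_le.
  by rewrite addn0 (leq_trans le) // homog_alpha.
rewrite existsbE => /hasP[p]; rewrite mem_permutations => pp /eqP eq gp.
have [c0|/card_gt0P[x0 _]] := posnP #|G|.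
  by move: gp; rewrite /gap subn_gt0 => /leq_trans/(_ (theta_le_card G)); rewrite c0.
have ps : perm_eq (map (nth x0 s) p) s.
  by rewrite -[X in perm_eq _ X](mkseq_nth x0) perm_map.
have up : uniq p by rewrite (perm_uniq pp) iota_uniq.
apply: (rows_iso y0 (s := map (nth x0 s) p) (t := t)) => //.
- by rewrite (perm_uniq ps).
- by move=> x; rewrite (perm_mem ps).
rewrite -permute_rowsE //; apply/allP => i; rewrite (perm_mem pp) mem_iota.
by case/andP.
Qed.

Lemma alpha_max_homog (s : seq G) : uniq s -> size s = #|G| ->
  alpha G = max_homog false (rows s [::]) (nseq (size s) true).
Proof.
move=> us sz; rewrite nseq_predT; apply/eqP; rewrite eqn_leq; apply/andP; split.
  have [S /stableP st <-] := alpha_witness G; rewrite cardE.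
  apply: max_homog_complete; first exact: enum_uniq.
    by move=> x _; rewrite mem_filter uniq_full.
  by move=> x y; rewrite !mem_enum => xS yS _; apply/negbTE/st.
have [st [ust _ hst <-]] := max_homog_sound false predT us.
exact: homog_alpha.
Qed.

Lemma clique_max_homog (s t : seq G) : uniq s -> size s = #|G| -> uniq t -> homog true t ->
  size t <= max_homog true (rows s [::]) (nseq (size s) true).
Proof.
move=> us sz ut ht; rewrite nseq_predT; apply: max_homog_complete => //.
by move=> x _; rewrite mem_filter uniq_full.
Qed.

Lemma triangle_free_size (t : seq G) : triangle_free G -> uniq t -> homog true t ->
  size t <= 2.
Proof.
move=> tf; case: t => [|x [|y [|z t]]] // /and3P[] + + _ ht.
rewrite !inE !negb_or => /and3P[xy xz _] /andP[yz _].
by case: tf; exists x, y, z; split; apply: ht => //; rewrite !inE eqxx ?orbT.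
Qed.

Lemma size_triangle_free :
  (forall t : seq G, uniq t -> homog true t -> size t <= 2) -> triangle_free G.
Proof.
move=> h [x [y [z [xy yz xz]]]].
have neq (u v : G) : adj u v -> u != v by apply: contraTneq => ->; rewrite adj_irr.
suff : size [:: x; y; z] <= 2 by [].
apply: h; first by rewrite /= !inE !negb_or !neq.
move=> u v; rewrite !inE => /or3P[]/eqP-> /or3P[]/eqP->; rewrite ?eqxx // => _.
- by rewrite adj_sym.
- by rewrite adj_sym.
- by rewrite adj_sym.
Qed.

(** The classes of an optimal clique coloring have at most [w] vertices each. *)
Lemma card_le_theta (w : nat) :
  (forall t : seq G, uniq t -> homog true t -> size t <= w) -> #|G| <= w * theta G.
Proof.
move=> hw; have [c cc le] := theta_coloring G.
rewrite -cardsT -sum1_card (partition_big_imset c) /= mulnC.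
apply: (@leq_trans (#|c @: [set: G]| * w)); last by rewrite leq_mul2r le orbT.
rewrite -sum_nat_const; apply: leq_sum => i _.
rewrite sum1_card cardE; apply: hw; first exact: enum_uniq.
move=> x y; rewrite !mem_enum => /andP[_ /eqP cx] /andP[_ /eqP cy].
by apply: cc; rewrite cx cy.
Qed.

Lemma triangle_free_theta : triangle_free G -> #|G| <= 2 * theta G.
Proof. by move=> tf; apply: card_le_theta => t; exact: triangle_free_size. Qed.

End GapCheck.

(** Explicit lists with closed proofs, on which [rows] evaluates. *)
Definition ords5 : seq 'I_5 := [:: @Ordinal 5 0 isT; @Ordinal 5 1 isT;
  @Ordinal 5 2 isT; @Ordinal 5 3 isT; @Ordinal 5 4 isT].
Definition ords7 : seq 'I_7 := [:: @Ordinal 7 0 isT; @Ordinal 7 1 isT;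
  @Ordinal 7 2 isT; @Ordinal 7 3 isT; @Ordinal 7 4 isT; @Ordinal 7 5 isT;
  @Ordinal 7 6 isT].
Definition ords8 : seq 'I_8 := [:: @Ordinal 8 0 isT; @Ordinal 8 1 isT;
  @Ordinal 8 2 isT; @Ordinal 8 3 isT; @Ordinal 8 4 isT; @Ordinal 8 5 isT;
  @Ordinal 8 6 isT; @Ordinal 8 7 isT].

Definition verts_C5 : seq C5 := ords5.
Definition verts_C5K1 : seq (dunion C5 K1) :=
  map inl ords5 ++ [:: inr (@Ordinal 1 0 isT)].

Lemma gap_check5 : all_rows 5 (gap_check (rows verts_C5 [::])).
Proof. by vm_compute. Qed.

Definition triangle_free_check (R : seq bitseq) : bool :=
  if 2 < max_homog true R (nseq (size R) true) then true
  else gap_check (rows verts_C5K1 [::]) R.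

Lemma triangle_free_check6 : all_sorted 4 0 (fun l => all_rows 4 (fun R =>
  triangle_free_check (two_rows l R))).
Proof. by vm_compute. Qed.

(** * Graphs of gap 2 *)

Lemma gap5_iso (G : sgraph) : #|G| = 5 -> 0 < gap G -> iso G C5.
Proof.
move=> c5; have sz : size (enum G) = #|G| by rewrite cardE.
apply: (@gap_check_sound _ C5 ord0 (enum G) verts_C5); rewrite ?enum_uniq //.
  by rewrite card_ord.
by apply: (all_rowsP gap_check5); rewrite sz.
Qed.

(** Triangle-freeness matters here: the wheel with five spokes also has 6 vertices and gap 1. *)
Lemma gap6_iso (G : sgraph) : triangle_free G -> #|G| = 6 -> 0 < gap G ->
  iso G (dunion C5 K1).
Proof.
move=> tf c6; have sz : size (enum G) = 6 by rewrite -cardE.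
have [/existsP[v /existsP[w /andP[vw nvw]]]|/existsPn comp] :=
  boolP [exists v : G, exists w : G, (v != w) && ~~ adj v w]; last first.
  suff : size (enum G) <= 2 by rewrite sz.
  apply: triangle_free_size tf (enum_uniq G) _ => x y _ _ nxy.
  by have /existsPn/(_ y) := comp x; rewrite nxy /= => /negPn.
have [s ps] := sorted_enumeration triangle_free_check6 (enum_uniq G) sz
  (etrans (mem_enum G v) isT) (etrans (mem_enum G w) isT) vw nvw.
have us : uniq s by rewrite (perm_uniq ps) enum_uniq.
have szs : size s = #|G| by rewrite (perm_size ps) cardE.
have [t [ut _ ht szt]] := max_homog_sound true predT us.
rewrite /triangle_free_check size_rows nseq_predT -szt ltnNge.
rewrite (triangle_free_size tf ut ht) /= => chk.
apply: (@gap_check_sound _ (dunion C5 K1) (inl ord0) s verts_C5K1) chk => //.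
by rewrite card_dunion !card_ord.
Qed.

Lemma C5_invariants : [/\ triangle_free C5, alpha C5 = 2 & gap C5 = 1].
Proof.
have sz : size verts_C5 = #|C5| by rewrite card_ord.
have us : uniq verts_C5 by [].
have tf : triangle_free C5.
  by apply: size_triangle_free => t ut /(clique_max_homog us sz ut).
have aC : alpha C5 = 2 by rewrite (alpha_max_homog us sz).
split=> //; apply/eqP; rewrite eqn_leq gap_le ?gap_ge // aC.
  by have := triangle_free_theta tf; rewrite -sz /=; case: theta => [|[|[]]].
exact: (coverable_theta us sz).
Qed.

Lemma triangle_free_edgeless n : triangle_free (edgeless n).
Proof. by case=> x [y [z []]]. Qed.

Lemma padding_isolated (G H : sgraph) k : 0 < k -> iso (dunion G (edgeless k)) H ->
  exists y : H, forall z, ~~ adj y z.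
Proof.
case: k => // k _ [f [[g fK gK] fa]]; exists (f (inr ord0)) => z.
by rewrite -(gK z) fa; case: (g z).
Qed.

Lemma C5_not_isolated (y : C5) : exists z, adj y z.
Proof.
case: y => -[|[|[|[|[|//]]]]] ?.
- by exists (@Ordinal 5 1 isT).
- by exists (@Ordinal 5 2 isT).
- by exists (@Ordinal 5 3 isT).
- by exists (@Ordinal 5 4 isT).
- by exists (@Ordinal 5 0 isT).
Qed.

Lemma card_C5 : #|C5| = 5.
Proof. exact: card_ord. Qed.

Lemma card_edgeless n : #|edgeless n| = n.
Proof. exact: card_ord. Qed.

(** Below 5 vertices, padding would produce a copy of C5 with an isolated vertex. *)
Lemma gap_le5_iso (G : sgraph) : #|G| <= 5 -> 0 < gap G -> iso G C5.
Proof.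
move=> c5 gG; case: (eqVneq #|G| 5) => [/gap5_iso/(_ gG)//|neq].
have lt5 : 0 < 5 - #|G| by rewrite subn_gt0 ltn_neqAle neq.
have i : iso (dunion G (edgeless (5 - #|G|))) C5.
  apply: gap5_iso; first by rewrite card_dunion card_edgeless subnKC.
  by rewrite gap_dunion gap_edgeless addn0.
have [y ny] := padding_isolated lt5 i.
by have [z] := C5_not_isolated y; rewrite (negPf (ny z)).
Qed.

Lemma gap2_triangle_free (G : sgraph) : #|G| <= 10 -> 1 < gap G -> triangle_free G.
Proof.
move=> c10 gG [x [y [z [xy yz xz]]]].
suff : gap (dunion G (edgeless (10 - #|G|))) <= 1.
  by rewrite gap_dunion gap_edgeless addn0 leqNgt gG.
apply: gap_triangle10; first by rewrite card_dunion card_edgeless subnKC.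
by apply; exists (inl x), (inl y), (inl z).
Qed.

Theorem gap2_iso (G : sgraph) : #|G| <= 10 -> 1 < gap G -> iso G (dunion C5 C5).
Proof.
move: {2}#|G|.+1 (ltnSn #|G|) => n; elim: n G => // n IHn G ltn c10 gG.
have card2 : #|dunion C5 C5| = 10 by rewrite card_dunion card_C5.
have IH (H : sgraph) : #|H| < #|G| -> gap H <= 1.
  move=> ltH; rewrite leqNgt; apply/negP => gH.
  have ltH10 : #|H| < 10 by apply: leq_trans ltH c10.
  have [cH _ _] := iso_invariants (IHn H (leq_trans ltH ltn) (ltnW ltH10) gH).
  by move: ltH10; rewrite cH card2.
have tf := gap2_triangle_free c10 gG.
have thG : (alpha G).+2 <= theta G by rewrite theta_gap -addn2 leq_add2l.
(* theta(G - v) <= alpha(G - v) + 1 <= alpha(G) + 1 < theta(G). *)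
have crit (v : G) : theta (induced [set~ v]) < theta G.
  apply: leq_trans thG; rewrite ltnS theta_gap -addn1.
  apply: leq_add; first exact: alpha_isometric (induced_isometric _).
  by apply: IH; rewrite card_induced cardsC1; have /card_gt0P := ex_intro _ v isT; case: #|G|.
have [/forallP conn|] := boolP [forall x : G, forall y : G, connect (@adj G) x y].
  have th : 2 * theta G <= #|G|.+1 by apply: gallai => // x y; exact: (forallP (conn x)).
  (* Here 2 (alpha(G) + 2) <= 2 theta(G) <= m + 1. *)
  have aG k m : #|G| <= m -> m.+1 < 2 * k.+2 -> alpha G < k.
    move=> cm; rewrite ltnNge [alpha G < k]ltnNge; apply: contra => ka.
    apply: (@leq_trans (2 * theta G)); last exact: leq_trans th _.
    by rewrite leq_mul2l (leq_trans _ thG).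
  have cG (m k : nat) : (triangle_free G -> m < #|G| -> k <= alpha G) ->
      alpha G < k -> #|G| <= m.
    by move=> ram ak; rewrite leqNgt; apply/negP => /(ram tf); rewrite leqNgt ak.
  (* The bounds 10, 8, 5, 2 on |G| give in turn alpha(G) < 4, 3, 2 and finally the absurd alpha(G) <
     0. *)
  have c8 := cG _ _ (@ramsey34_alpha G) (aG 4 _ c10 isT).
  have c5 := cG _ _ (@ramsey33_alpha G) (aG 3 _ c8 isT).
  have c2 := cG _ _ (@ramsey32_alpha G) (aG 2 _ c5 isT).
  by have := aG 0 _ c2 isT.
rewrite negb_forall => /existsP[x]; rewrite negb_forall => /existsP[y nxy].
pose A := [set u | connect (@adj G) x u].
have sep u w : u \in A -> w \notin A -> ~~ adj u w.
  rewrite !inE => xu; apply: contra => uw; exact: connect_trans xu (connect1 uw).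
have i := iso_dunion_induced sep.
have xA : x \in A by rewrite inE connect0.
have yA : y \notin A by rewrite inE.
have cA : #|A| + #|~: A| = #|G| by exact: cardsC.
have A0 : 0 < #|A| by apply/card_gt0P; exists x.
have B0 : 0 < #|~: A| by apply/card_gt0P; exists y; rewrite inE.
have gA : gap (induced A) <= 1.
  by apply: IH; rewrite card_induced -cA -{1}(addn0 #|A|) ltn_add2l.
have gB : gap (induced (~: A)) <= 1.
  by apply: IH; rewrite card_induced -cA -{1}(add0n #|~: A|) ltn_add2r.
have gAB : 1 < gap (induced A) + gap (induced (~: A)).
  by rewrite -gap_dunion (iso_gap i).
have gA' : 0 < gap (induced A).
  by move: gAB gB; case: (gap (induced A)) => //=; case: gap => [|[]].
have gB' : 0 < gap (induced (~: A)).
  by move: gAB gA; case: (gap (induced (~: A))) => //; rewrite addn0; case: gap => [|[]].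
(* With at most 10 vertices in all, each side then has exactly 5. *)
have ge5 (B : {set G}) : 0 < gap (induced B) -> 5 <= #|B|.
  move=> gB0; rewrite leqNgt; apply/negP => lt5.
  have [] := iso_invariants (gap_le5_iso (G := induced B) _ gB0).
    by rewrite card_induced ltnW.
  by rewrite card_induced card_C5 => eq; rewrite eq in lt5.
have le5A : #|A| <= 5.
  by rewrite -(leq_add2r 5) (leq_trans _ c10) // -cA leq_add2l ge5.
have le5B : #|~: A| <= 5.
  by rewrite -(leq_add2l 5) (leq_trans _ c10) // -cA leq_add2r ge5.
apply: iso_trans (iso_sym i) _.
by apply: iso_dunion; apply: gap_le5_iso => //; rewrite card_induced.
Qed.

Corollary gap_le9 (G : sgraph) : #|G| <= 9 -> gap G <= 1.
Proof.
move=> c9; rewrite leqNgt; apply/negP => gG.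
have [] := iso_invariants (gap2_iso (leqW c9) gG).
by rewrite card_dunion card_C5 => eq; rewrite eq in c9.
Qed.

(** * Extremal examples and (3,4)-Ramsey graphs *)

Definition wagner_adj : rel 'I_8 := fun i j =>
  cycle_adj i j || (i != j) && (((i + 4) %% 8 == j) || ((j + 4) %% 8 == i)).

Lemma wagner_adj_sym : symmetric wagner_adj.
Proof. by move=> i j; rewrite /wagner_adj cycle_adj_sym eq_sym [X in _ && X]orbC. Qed.

Lemma wagner_adj_irr : irreflexive wagner_adj.
Proof. by move=> i; rewrite /wagner_adj cycle_adj_irr eqxx. Qed.

(** The Wagner graph, an 8-cycle with its four long diagonals, witnesses R(3,4) > 8 and alpha(8) <=
    3. *)
Definition wagner : sgraph := SGraph wagner_adj_sym wagner_adj_irr.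

Lemma wagner_invariants : [/\ #|wagner| = 8, triangle_free wagner & alpha wagner = 3].
Proof.
pose s : seq wagner := ords8; have us : uniq s by [].
have sz : size s = #|wagner| by rewrite card_ord.
split; first exact: card_ord; last by rewrite (alpha_max_homog us sz).
by apply: size_triangle_free => t ut /(clique_max_homog us sz ut).
Qed.

Lemma C7_alpha : alpha C7 = 3.
Proof.
have us : uniq (ords7 : seq C7) by [].
by rewrite (alpha_max_homog us) // card_ord.
Qed.

Lemma max_gap_ge1 (n : nat) (G : sgraph) : n <= 9 -> #|G| = n -> 0 < gap G -> max_gap n G.
Proof. by move=> n9 cG gG; split=> // H cH; apply: leq_trans gG; rewrite gap_le9 // cH. Qed.

(** Seven vertices need four cliques of size at most 2, while alpha is 3. *)
Lemma gap_C7 : 0 < gap C7.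
Proof.
have us : uniq (ords7 : seq C7) by [].
have sz : size (ords7 : seq C7) = #|C7| by rewrite card_ord.
apply: gap_ge; rewrite C7_alpha; have : #|C7| <= 2 * theta C7.
  by apply: card_le_theta => t ut /(clique_max_homog us sz ut).
by rewrite card_ord; case: theta => [|[|[|[]]]].
Qed.

(** Seven vertices need three cliques of size at most 3, while alpha is 2. *)
Lemma gap_compl_C7 : 0 < gap (compl C7).
Proof.
pose s : seq (compl C7) := ords7; have us : uniq s by [].
have sz : size s = #|compl C7| by rewrite card_ord.
apply: gap_ge; rewrite (alpha_max_homog us sz); have : #|compl C7| <= 3 * theta (compl C7).
  by apply: card_le_theta => t ut /(clique_max_homog us sz ut).
by rewrite card_ord; case: theta => [|[|[]]].
Qed.

Lemma is_gap2_1 (n : nat) (G : sgraph) : n <= 9 -> #|G| = n -> triangle_free G ->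
  0 < gap G -> is_gap2 n (gap G).
Proof.
move=> n9 cG tf gG; split; first by exists G.
by move=> _ [H [cH _ <-]]; apply: leq_trans gG; rewrite gap_le9 // cH.
Qed.

Lemma alpha_le3 (G : sgraph) :
  no_triangle_no_stable4 G <-> triangle_free G /\ alpha G <= 3.
Proof.
split=> -[tf aG]; split=> //.
  by rewrite leqNgt; apply/negP => /stable_subcard[S st cS]; apply: aG; exists S.
by move=> [S /leq_alpha + cS]; rewrite cS leqNgt ltnS aG.
Qed.

(** The order 8 comes from [ramsey34_alpha] above and from the Wagner graph below. *)
Lemma ramsey34_card (R : sgraph) : ramsey34 R <->
  [/\ #|R| = 8, triangle_free R & alpha R <= 3].
Proof.
have [cW tW aW] := wagner_invariants.
have le8 (H : sgraph) : triangle_free H -> alpha H <= 3 -> #|H| <= 8.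
  by move=> tH aH; rewrite leqNgt; apply/negP => /(ramsey34_alpha tH); rewrite ltnNge aH.
split=> [[/alpha_le3[tR aR] maxR]|[cR tR aR]].
  split=> //; apply/eqP; rewrite eqn_leq le8 //= -cW; apply: maxR.
  by apply/alpha_le3; rewrite aW.
split; first exact/alpha_le3.
by move=> H /alpha_le3[tH aH]; rewrite cR le8.
Qed.

(** 2 alpha(G) <= 2 [k] < |G| <= 2 theta(G). *)
Lemma triangle_free_gap (k : nat) (G : sgraph) : triangle_free G -> alpha G <= k ->
  2 * k < #|G| -> 0 < gap G.
Proof.
move=> tf aG cG; apply: gap_ge; rewrite addn1; apply: leq_ltn_trans aG _.
by rewrite -(ltn_pmul2l (isT : 0 < 2)) (leq_trans cG) // triangle_free_theta.
Qed.

(** The last hypothesis is the Ramsey bound alpha(n) >= [k], attained by [G]; the gap is maximal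
    because no graph on at most 9 vertices has gap above 1. *)
Lemma stable_gap_optimal_of (n k : nat) (G : sgraph) : n <= 9 -> #|G| = n ->
  triangle_free G -> alpha G <= k -> 0 < gap G ->
  (forall H : sgraph, triangle_free H -> n <= #|H| -> k <= alpha H) ->
  stable_gap_optimal n G.
Proof.
move=> n9 cG tf aG gG ram; split=> //; first exact: is_gap2_1.
split; first by exists G.
by move=> _ [H [cH tH <-]]; apply: leq_trans aG _; apply: ram; rewrite ?cH.
Qed.

Lemma stable_gap_optimal_le (n : nat) (G H : sgraph) : stable_gap_optimal n G ->
  #|H| = n -> triangle_free H -> alpha G <= alpha H.
Proof. by move=> [_ _ _ [_ minG]] cH tH; apply: minG; exists H. Qed.

Theorem theorem5p2 :
  (gap_extremal (dunion C5 C5) /\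
   is_s 2 10 /\ is_s2 2 10 /\
   (forall G : sgraph, t_extremal 2 G <-> iso G (dunion C5 C5))) /\
  (forall n : nat, 6 <= n <= 9 ->
     forall H : sgraph, #|H| = n - 5 -> max_gap n (dunion C5 H)) /\
  (max_gap 6 (dunion C5 K1) /\
   (forall G : sgraph, triangle_free G -> max_gap 6 G -> iso G (dunion C5 K1)) /\
   stable_gap_optimal 6 (dunion C5 K1)) /\
  (max_gap 7 C7 /\ max_gap 7 (compl C7) /\
   (forall (R : sgraph) (v : R), ramsey34 R ->
      max_gap 7 (delete v) /\ stable_gap_optimal 7 (delete v))) /\
  (forall G : sgraph, stable_gap_optimal 8 G <-> ramsey34 G) /\
  (forall G : sgraph, #|G| = 9 ->
     (stable_gap_optimal 9 G <-> triangle_free G /\ alpha G = 4)).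
Proof.
have [tC aC gC] := C5_invariants.
have [cW tW aW] := wagner_invariants.
have c2 : #|dunion C5 C5| = 10 by rewrite card_dunion card_C5.
have g2 : gap (dunion C5 C5) = 2 by rewrite gap_dunion gC.
have min10 (G : sgraph) : gap G = 2 -> 10 <= #|G|.
  by move=> gG; rewrite ltnNge; apply/negP => /gap_le9; rewrite gG.
have s10 : is_s 2 10.
  by split; [exists (dunion C5 C5) | move=> _ [G [<- /min10]]].
have gap_C5 (H : sgraph) : 0 < gap (dunion C5 H) by rewrite gap_dunion gC.
have cK : #|dunion C5 K1| = 6 by rewrite card_dunion card_C5 card_edgeless.
have tK : triangle_free (dunion C5 K1).
  exact: triangle_free_dunion tC (@triangle_free_edgeless 1).
split; [split; [|split; [|split]]|split; [|split; [|split; [|split]]]].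
- by exists 2; split; rewrite ?c2.
- exact: s10.
- split; last by move=> _ [G [<- _ /min10]].
  by exists (dunion C5 C5); split=> //; exact: triangle_free_dunion.
- move=> G; split=> [[gG [_ minG]]|i].
    by apply: gap2_iso; [apply: minG; case: s10 | rewrite gG].
  by have [cG _ _] := iso_invariants i; split; rewrite ?(iso_gap i) // cG c2.
- move=> n /andP[n6 n9] H cH; apply: max_gap_ge1 => //.
  by rewrite card_dunion card_C5 cH subnKC // ltnW.
- have mK : max_gap 6 (dunion C5 K1) by exact: max_gap_ge1.
  split=> //; split=> [G tf [cG maxG]|].
    by apply: gap6_iso => //; apply: leq_trans (maxG _ cK).
  apply: (@stable_gap_optimal_of 6 3) => //; last by move=> H; exact: ramsey33_alpha.
  by rewrite alpha_dunion alpha_edgeless aC.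
- split; first exact: (@max_gap_ge1 7 C7 isT (card_ord 7) gap_C7).
  split; first exact: (@max_gap_ge1 7 (compl C7) isT (card_ord 7) gap_compl_C7).
  move=> R v /ramsey34_card[cR tR aR].
  have iv : isometric (val : delete v -> R) by split=> //; exact: val_inj.
  have cD : #|delete v| = 7.
    by rewrite card_sig (eq_card (B := predC1 v)) // cardC1 cR.
  have tD := triangle_freeW iv tR.
  have aD : alpha (delete v) <= 3 by exact: leq_trans (alpha_isometric iv) aR.
  have gD : 0 < gap (delete v) by apply: triangle_free_gap tD aD _; rewrite cD.
  split; first exact: max_gap_ge1.
  apply: (@stable_gap_optimal_of 7 3) => // H tH cH.
  by apply: ramsey33_alpha => //; exact: ltnW.
- move=> G; split=> [oG|/ramsey34_card[cG tG aG]].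
    apply/ramsey34_card; case: (oG) => cG tG _ _; split=> //.
    by rewrite -aW (stable_gap_optimal_le oG).
  apply: (@stable_gap_optimal_of 8 3) => // [|H tH cH].
    by apply: triangle_free_gap tG aG _; rewrite cG.
  by apply: ramsey33_alpha => //; apply: leq_trans cH.
- move=> G cG; split=> [oG|[tG aG]].
    case: (oG) => _ tG _ _; split=> //; apply/eqP; rewrite eqn_leq andbC.
    rewrite ramsey34_alpha ?cG //=.
    (* The Wagner graph with an isolated vertex witnesses alpha(9) <= 4. *)
    have -> : 4 = alpha (dunion wagner K1) by rewrite alpha_dunion alpha_edgeless aW.
    apply: stable_gap_optimal_le oG _ _.
      by rewrite card_dunion card_edgeless cW.
    exact: triangle_free_dunion tW (@triangle_free_edgeless 1).
  apply: (@stable_gap_optimal_of 9 4) => //; rewrite ?aG //.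
    by apply: (@triangle_free_gap 4) => //; rewrite ?aG ?cG.
  exact: ramsey34_alpha.
Qed.
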